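(* Let $G \leq \mathrm{Homeo}(\mathbb{R})$ be a subgroup with at most $2$ fixed points, i.e. every non-trivial element of $G$ has at most $2$ fixed points in $\mathbb{R}$. Then we have two possibilities: \begin{itemize} \item $G_+$ is abelian, and every fixed point of a non-trivial element of $G_+$ is a global fixed point of $G_+$, or \item the action of $G$ is semi-conjugate to an action by affine transformations, i.e. $G$ is semi-conjugate to some subgroup $F$ of $\mathrm{Aff}(\mathbb{R})$. \end{itemize}
   Context: $\mathrm{Homeo}(\mathbb{R})$ is the group of all homeomorphisms of $\mathbb{R}$ and $\mathrm{Homeo}_+(\mathbb{R})$ is the subgroup of orientation-preserving (increasing) ones. For $G\le \mathrm{Homeo}(\mathbb{R})$, $G_+ = G\cap \mathrm{Homeo}_+(\mathbb{R})$. $\mathrm{Aff}(\mathbb{R})$ is the group of affine transformations $x\mapsto ax+b$ of $\mathbb{R}$, with $a\neq 0$. A global fixed point of a group of homeomorphisms is a point fixed by all its elements. A function $h:\mathbb{R}\to\mathbb{R}$ is a monotone proper map if $h$ is non-decreasing and $\lim_{x\to\pm\infty}h(x)=\pm\infty$. For subgroups $G,F\le\mathrm{Homeo}(\mathbb{R})$, the action of $G$ is semi-conjugate to $F$ if there exist a surjective group morphism $\theta:G\to F$ and a continuous monotone proper map $h:\mathbb{R}\to\mathbb{R}$ such that $\theta(g)\circ h=h\circ g$ for every $g\in G$. *)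

(* Defs.v *)
From mathcomp Require Import all_boot all_order all_algebra.
From mathcomp Require Import boolp classical_sets functions cardinality reals.
From mathcomp Require Import topology normedtype.

Set Implicit Arguments.
Unset Strict Implicit.
Unset Printing Implicit Defensive.

Import Order.TTheory GRing.Theory Num.Theory.
Import numFieldNormedType.Exports.

Local Open Scope classical_set_scope.
Local Open Scope ring_scope.

Section HomeoLine.
Variable R : realType.
Implicit Types (f g h : R -> R) (G F : set (R -> R)) (x : R).

Definition Homeo : set (R -> R) :=
  [set f : R -> R | continuous f /\
                    exists2 g : R -> R, continuous g & cancel f g /\ cancel g f].

Definition HomeoPlus : set (R -> R) :=
  [set f | Homeo f /\ {homo f : x y / x < y}].

Definition Aff : set (R -> R) :=
  [set f : R -> R | exists a b : R, a != 0 /\ f = (fun x : R => a * x + b : R)].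

(* Elements of Homeo are plain functions, so closure under inversion is
   expressed with an arbitrary two-sided inverse, which exists and is unique. *)
Definition is_subgroup G : Prop :=
  [/\ G `<=` Homeo,
      G idfun,
      (forall f g, G f -> G g -> G (f \o g)) &
      (forall f g, G f -> cancel f g -> cancel g f -> G g)].

Definition plus_part G : set (R -> R) := G `&` HomeoPlus.

Definition is_abelian G : Prop :=
  forall f g, G f -> G g -> f \o g = g \o f.

Definition fixed_points f : set R := [set x | f x = x].

Definition global_fixed_point G x : Prop := forall g, G g -> fixed_points g x.

Definition at_most_fixed_points (n : nat) G : Prop :=
  forall g, G g -> g <> idfun -> (fixed_points g #<= `I_n)%card.

Definition monotone_proper h : Prop :=
  [/\ {homo h : x y / x <= y},
      h x @[x --> -oo] --> -oo &
      h x @[x --> +oo] --> +oo].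

(* theta is a total function on R -> R of which only the restriction to G
   matters. *)
Definition semi_conjugate G F : Prop :=
  exists (theta : (R -> R) -> (R -> R)) (h : R -> R),
    [/\ theta @` G = F,
        (forall f g, G f -> G g -> theta (f \o g) = theta f \o theta g),
        continuous h,
        monotone_proper h &
        forall g, G g -> theta g \o h = h \o g].

End HomeoLine.
Arguments Aff : clear implicits.

(* Main.v *)
Require Import Defs.
From HB Require Import structures.
From mathcomp Require Import all_boot all_order all_algebra.
From mathcomp Require Import boolp classical_sets functions cardinality reals.
From mathcomp Require Import topology normedtype realfun.
From mathcomp Require Import ring lra zify.

(** Let H be the group of increasing elements of G.  Two distinct elements of H
agree in at most two points, so they are ordered near +oo; this makes H a
bi-ordered group ([ltoo_biorder]).  As in the proof of Hölder's theorem, the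
elements of an Archimedean class have a real length, which is additive, so that
their commutators are negligible against the class ([commutator_negligible]).  In
particular a subgroup acting freely is abelian ([free_abelian]).

Suppose that H has no global fixed point and that some nontrivial element has a
fixed point.  The heart of the proof is to find a nontrivial normal subgroup D
that acts freely ([exists_free_normal]).  Up to inversion, an element with fixed
points moves points to the right near +oo; near -oo it moves them to the left
(expanding) or to the right (parabolic).  Counting the points where powers of two
such elements agree shows that all parabolic elements lie in one Archimedean
class ([parabolic_lt_exp], [parabolic_exp_gt]), and that in a group without
parabolic elements the same holds for the expanding ones ([expanding_lt_exp],
[expanding_exp_gt]).  The elements negligible against such a class form a normal
subgroup that contains no element of the class, and that is not trivial because
it contains commutators ([infinitesimals_nontrivial]).  Passing to it for the
parabolic elements, and again for the expanding ones if any are left, eliminates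
both types.

The lengths of the elements of D are dense in the real numbers: a least positive
element would commute with all of H, and an element with a fixed point would then
fix an entire orbit ([tau_small]).  So D determines a monotone coordinate on the
line in which it acts by translations, and this coordinate is unique up to affine
maps ([coord_unique]).  Hence H acts by affine maps in this coordinate, and the
elements acting by translations are those without fixed points, together with
the identity ([fixfreeP]).  This last description is invariant under all of G,
including the decreasing elements, so with the group of translations in the place
of D the uniqueness of the coordinate makes all of G act by affine maps
([semi_conjugate_affine]).

If H acts freely, it is abelian.  There remains the case of a global fixed point
p.  If a nontrivial element fixed another point that is not global, then H would
act without global fixed points on both rays of origin p, each element having at
most one fixed point on the two rays together.  The translations of the two rays
are then incompatible ([two_lines_free]).  So all fixed points are global, H acts
freely on the right of the last one, and it is abelian ([global_abelian]). *)

Set Implicit Arguments.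
Unset Strict Implicit.
Unset Printing Implicit Defensive.

Import Order.TTheory GRing.Theory Num.Theory.
Import numFieldNormedType.Exports.

Local Open Scope classical_set_scope.

(** * Bi-ordered groups *)

Section BiOrder.
Local Open Scope group_scope.
Variables (Gam : groupType).

Record biorder (lt : Gam -> Gam -> Prop) : Prop := {
  bo_irr : forall x, ~ lt x x;
  bo_trans : forall x y z, lt x y -> lt y z -> lt x z;
  bo_total : forall x y, x <> y -> lt x y \/ lt y x;
  bo_mull : forall z x y, lt x y -> lt (z * x) (z * y);
  bo_mulr : forall z x y, lt x y -> lt (x * z) (y * z) }.

(** All powers of [f] stay below [d]: [f] belongs to a strictly smaller
Archimedean class than [d]. *)
Definition negligible (lt : Gam -> Gam -> Prop) (f d : Gam) :=
  forall n : nat, lt (f ^+ n) d /\ lt (f^-1 ^+ n) d.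

Variables (lt : Gam -> Gam -> Prop) (ltB : biorder lt).
Local Notation "x <o y" := (lt x y) (at level 70).
Local Notation "x <=o y" := (~ lt y x) (at level 70).

Lemma bo_leP x y : x <=o y -> x = y \/ x <o y.
Proof.
move=> h; have [->|/bo_total] := pselect (x = y); first by left.
by case/(_ lt ltB) => ?; [right|].
Qed.

Lemma bo_le_lt_trans x y z : x <=o y -> y <o z -> x <o z.
Proof. by case/bo_leP => [->//|h1 h2]; exact: (bo_trans ltB h1 h2). Qed.

Lemma bo_lt_le_trans x y z : x <o y -> y <=o z -> x <o z.
Proof. by move=> h /bo_leP[<-//|h2]; exact: (bo_trans ltB h h2). Qed.

Lemma bo_le_trans x y z : x <=o y -> y <=o z -> x <=o z.
Proof. by move=> h1 h2 h3; exact: h2 (bo_lt_le_trans h3 h1). Qed.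

Lemma bo_ltW x y : x <o y -> x <=o y.
Proof. by move=> h1 h2; exact: (bo_irr ltB (bo_trans ltB h1 h2)). Qed.

Lemma bo_le_total x y : x <=o y \/ y <=o x.
Proof. by have [/bo_ltW|] := pselect (x <o y); [left|right]. Qed.

Lemma bo_le_mul x y z t : x <=o y -> z <=o t -> x * z <=o y * t.
Proof.
move=> h1 h2; apply: (@bo_le_trans _ (y * z)).
  by case: (bo_leP h1) => [->|/(bo_mulr ltB z)/bo_ltW//]; exact: (bo_irr ltB).
by case: (bo_leP h2) => [->|/(bo_mull ltB y)/bo_ltW//]; exact: (bo_irr ltB).
Qed.

Lemma bo_lt_mul x y z t : x <o y -> z <=o t -> x * z <o y * t.
Proof.
move=> h1 /bo_leP[<-|h2]; first exact: bo_mulr.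
exact: (bo_trans ltB (bo_mulr ltB z h1) (bo_mull ltB y h2)).
Qed.

Lemma bo_le_exp x y n : x <=o y -> x ^+ n <=o y ^+ n.
Proof.
move=> h; elim: n => [|n IH]; first exact: (bo_irr ltB).
by rewrite !expgS; exact: bo_le_mul.
Qed.

Arguments bo_le_exp [x y] n _ _.

Lemma bo_lt_exp x y n : x <o y -> (0 < n)%N -> x ^+ n <o y ^+ n.
Proof.
by case: n => // n h _; rewrite !expgS; apply: bo_lt_mul h (bo_le_exp _ (bo_ltW h)).
Qed.

Lemma bo_exp_gt1 x n : 1 <o x -> (0 < n)%N -> 1 <o x ^+ n.
Proof. by move=> h n0; have := bo_lt_exp h n0; rewrite expg1n. Qed.

Lemma bo_ltV x y : x <o y -> y^-1 <o x^-1.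
Proof.
move=> /(bo_mull ltB (x^-1 : Gam))/(bo_mulr ltB (y^-1 : Gam)).
by rewrite mulVg mul1g mulgK.
Qed.

Lemma bo_leV x y : x <=o y -> y^-1 <=o x^-1.
Proof. by move=> h /bo_ltV; rewrite !invgK. Qed.

Lemma bo_lt1V x : x <o 1 -> 1 <o x^-1.
Proof. by move/bo_ltV; rewrite invg1. Qed.

Lemma conjVX (g x : Gam) n : (g * x * g^-1) ^+ n = g * x ^+ n * g^-1.
Proof.
elim: n => [|n IH]; first by rewrite !expg0 mulg1 mulgV.
by rewrite !expgS IH !mulgA mulgVK.
Qed.

Lemma conjVV (g x : Gam) : (g * x * g^-1)^-1 = g * x^-1 * g^-1.
Proof. by rewrite !invgM invgK mulgA. Qed.

Lemma negligible1 d : 1 <o d -> negligible lt 1 d.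
Proof. by move=> h n; rewrite invg1 !expg1n. Qed.

Lemma negligibleV f d : negligible lt f d -> negligible lt f^-1 d.
Proof. by move=> h n; rewrite invgK; case: (h n). Qed.

Lemma negligible_mul_half f g d :
  negligible lt f d -> negligible lt g d -> forall n, (f * g) ^+ n <o d.
Proof.
move=> hf hg n.
have [h|h] := bo_le_total f g.
  apply: (@bo_le_lt_trans _ ((g ^+ 2) ^+ n)); last first.
    by rewrite -expgnA; exact: (hg _).1.
  by apply: bo_le_exp; rewrite expg2; apply: bo_le_mul => //; exact: (bo_irr ltB).
apply: (@bo_le_lt_trans _ ((f ^+ 2) ^+ n)); last first.
  by rewrite -expgnA; exact: (hf _).1.
by apply: bo_le_exp; rewrite expg2; apply: bo_le_mul => //; exact: (bo_irr ltB).
Qed.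

(** The powers of [f * g] are bounded by those of the larger factor squared. *)
Lemma negligibleM f g d :
  negligible lt f d -> negligible lt g d -> negligible lt (f * g) d.
Proof.
move=> hf hg n; split; first exact: negligible_mul_half.
by rewrite invgM; apply: negligible_mul_half; exact: negligibleV.
Qed.

Lemma negligibleJ g f d :
  negligible lt f d -> negligible lt (g * f * g^-1) (g * d * g^-1).
Proof.
move=> h n; rewrite conjVV !conjVX; case: (h n) => h1 h2.
by split; apply: (bo_mulr ltB); apply: (bo_mull ltB).
Qed.

Definition zpow (b : Gam) (m : int) : Gam :=
  match m with Posz n => b ^+ n | Negz n => b^-1 ^+ n.+1 end.

Lemma zpow_succ b (m : int) : zpow b (m + 1)%R = zpow b m * b.
Proof.
case: m => [n|[|n]].
- have -> : (Posz n + 1)%R = Posz n.+1 by lia.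
  by rewrite /= expgSr.
- by rewrite /= expg1 mulVg.
- have -> : (Negz n.+1 + 1)%R = Negz n by lia.
  by rewrite /= (expgSr _ n.+1) mulgVK.
Qed.

Lemma zpow_pred b (m : int) : zpow b (m - 1)%R = zpow b m * b^-1.
Proof. by rewrite -{2}(subrK 1%R m) zpow_succ mulgK. Qed.

Lemma zpowD b (m n : int) : zpow b (m + n)%R = zpow b m * zpow b n.
Proof.
elim/int_ind: n => [|n IH|n IH]; first by rewrite addr0 /= mulg1.
  have -> : Posz n.+1 = (Posz n + 1)%R by lia.
  by rewrite addrA !zpow_succ IH mulgA.
have -> : (- (Posz n.+1))%R = ((- Posz n) - 1)%R by lia.
by rewrite addrA !zpow_pred IH mulgA.
Qed.

Lemma zpowX b (m : int) q : zpow b (m * Posz q)%R = zpow b m ^+ q.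
Proof.
elim: q => [|q IH]; first by rewrite mulr0.
have -> : (m * Posz q.+1)%R = (m + m * Posz q)%R by lia.
by rewrite zpowD IH expgS.
Qed.

Lemma zpow_gt1 b (m : int) : 1 <o b -> (0 < m)%R -> 1 <o zpow b m.
Proof. by case: m => [[|n]|n] // hb _; apply: (bo_exp_gt1 (n := n.+1)). Qed.

Lemma zpow_lt b (m n : int) : 1 <o b -> (m < n)%R -> zpow b m <o zpow b n.
Proof.
move=> hb mn; have -> : n = (m + (n - m))%R by lia.
rewrite zpowD -{1}(mulg1 (zpow b m)); apply: (bo_mull ltB).
by apply: zpow_gt1 => //; lia.
Qed.

Lemma zpow_le_inv b (m n : int) : 1 <o b -> zpow b m <=o zpow b n -> (m <= n)%R.
Proof. by move=> hb h; rewrite leNgt; apply/negP => /(zpow_lt hb). Qed.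

Lemma zpow_le b (m n : int) : 1 <o b -> (m <= n)%R -> zpow b m <=o zpow b n.
Proof.
move=> hb; rewrite le_eqVlt => /orP[/eqP ->|/(zpow_lt hb)/bo_ltW//].
exact: (bo_irr ltB).
Qed.

Lemma bo_swap x a n : x * a <=o a * x -> x * a ^+ n <=o a ^+ n * x.
Proof.
move=> h; elim: n => [|n IH]; first by rewrite !expg0 mulg1 mul1g; exact: bo_irr.
rewrite expgS mulgA; apply: (@bo_le_trans _ (a * (x * a ^+ n))).
  by rewrite !mulgA; apply: bo_le_mul => //; exact: (bo_irr ltB).
by rewrite -[in X in _ <=o X]mulgA; apply: bo_le_mul => //; exact: (bo_irr ltB).
Qed.

(** In a bi-ordered group these inequalities stand in for the identity
[(x * y) ^+ n = x ^+ n * y ^+ n], which needs commutation. *)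
Lemma bo_expM x y n : x * y <=o y * x ->
  x ^+ n * y ^+ n <=o (x * y) ^+ n /\ (y * x) ^+ n <=o y ^+ n * x ^+ n.
Proof.
move=> h; elim: n => [|n [IH1 IH2]].
  by rewrite !expg0 mulg1; split; exact: (bo_irr ltB).
have rf z : z <=o z by exact: (bo_irr ltB).
split.
  rewrite (expgS x) (expgSr y) (expgSr (x * y)).
  have -> : x * x ^+ n * (y ^+ n * y) = x * (x ^+ n * y ^+ n) * y by rewrite !mulgA.
  apply: (@bo_le_trans _ (x * (x * y) ^+ n * y)).
    by apply: bo_le_mul => //; apply: bo_le_mul.
  rewrite mulgA; apply: bo_le_mul => //; apply: bo_swap.
  by rewrite -mulgA; apply: bo_le_mul.
have -> : (y * x) ^+ n.+1 = y * (x * y) ^+ n * x.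
  elim: n {IH1 IH2} => [|n IH]; first by rewrite expg1 expg0 mulg1.
  by rewrite expgS IH expgS !mulgA.
have -> : y ^+ n.+1 * x ^+ n.+1 = y * (y ^+ n * x ^+ n) * x.
  by rewrite expgS expgSr !mulgA.
apply: bo_le_mul => //; apply: bo_le_mul => //.
by apply: (@bo_le_trans _ ((y * x) ^+ n)) => //; exact: bo_le_exp.
Qed.

Variables (R : realType) (b : Gam) (b_gt1 : 1 <o b).

(** The elements for which [b] can serve as a unit of length. *)
Definition dominated (x : Gam) : Prop :=
  exists k : nat, zpow b (- Posz k)%R <=o x /\ x <=o zpow b k.

(** The length of [x] in units of [b]: the supremum of the ratios [m / q] with
[b ^ m] below [x ^ q]. *)
Definition holder (x : Gam) : R :=
  sup [set r | exists (m : int) (q : nat),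
         [/\ (0 < q)%N, zpow b m <=o x ^+ q & r = (m%:~R / q%:R)%R]].

Lemma dominatedM x y : dominated x -> dominated y -> dominated (x * y).
Proof.
move=> [k [k1 k2]] [l [l1 l2]]; exists (k + l)%N.
have -> : (- Posz (k + l))%R = (- Posz k + - Posz l)%R by lia.
by rewrite PoszD !zpowD; split; apply: bo_le_mul.
Qed.

Lemma zpowN (m : int) : zpow b (- m)%R = (zpow b m)^-1.
Proof. by apply/esym/mulg1_eq; rewrite -zpowD subrr. Qed.

Lemma dominatedV x : dominated x -> dominated x^-1.
Proof.
move=> [k [k1 k2]]; exists k; rewrite zpowN; split; first exact: bo_leV.
by move: k1; rewrite zpowN => /bo_leV; rewrite invgK.
Qed.

Lemma ratio_le (m n : int) (p q : nat) (x : Gam) : (0 < p)%N -> (0 < q)%N ->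
  zpow b m <=o x ^+ p -> x ^+ q <=o zpow b n ->
  (m%:~R / p%:R <= n%:~R / q%:R :> R)%R.
Proof.
move=> p0 q0 /(bo_le_exp q) h1 /(bo_le_exp p) h2.
have hh : (m * Posz q <= n * Posz p)%R.
  apply: (zpow_le_inv b_gt1); rewrite !zpowX.
  by apply: bo_le_trans h1 _; rewrite -expgnA mulnC expgnA.
rewrite ler_pdivrMr ?ltr0n// mulrAC ler_pdivlMr ?ltr0n//.
rewrite -[(q%:R)%R]/((Posz q)%:~R)%R -[(p%:R)%R]/((Posz p)%:~R)%R.
by rewrite -!intrM ler_int.
Qed.

Lemma holder_ge x m q : dominated x -> (0 < q)%N -> zpow b m <=o x ^+ q ->
  (m%:~R / q%:R <= holder x)%R.
Proof.
move=> [k [k1 k2]] q0 h; apply: sup_upper_bound; last by exists m, q.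
split; first by exists (m%:~R / q%:R)%R, m, q.
exists (k%:~R / 1%:R)%R => _ [n [p [p0 hn ->]]].
by apply: (ratio_le p0 _ hn); rewrite ?expg1.
Qed.

Lemma holder_le x m q : dominated x -> (0 < q)%N -> x ^+ q <=o zpow b m ->
  (holder x <= m%:~R / q%:R)%R.
Proof.
move=> [k [k1 k2]] q0 h; apply: sup_le_ub.
  by exists ((- Posz k)%:~R / 1%:R)%R, (- Posz k)%R, 1%N; rewrite expg1.
by move=> _ [n [p [p0 hn ->]]]; exact: (ratio_le p0 q0 hn h).
Qed.

(** Since [x ^+ q] is caught between consecutive powers of [b], the length of [x]
is known up to [1 / q]. *)
Lemma zpow_floor x q : dominated x ->
  exists m : int, zpow b m <=o x ^+ q /\ x ^+ q <o zpow b (m + 1)%R.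
Proof.
move=> [k [k1 k2]].
(* Since [b ^ (- k * q)] is at most [x ^+ q], shifting the exponents by [k * q]
reduces the search to natural numbers. *)
pose Q (n : nat) := `[< x ^+ q <o zpow b (Posz n - Posz (k * q))%R >].
have exQ : exists n, Q n.
  exists ((k * q).*2.+1); apply/asboolP.
  apply: (@bo_le_lt_trans _ (zpow b (Posz k * Posz q)%R)).
    by rewrite zpowX; exact: bo_le_exp.
  by apply: zpow_lt => //; lia.
case: (ex_minnP exQ) => n /asboolP hn nmin.
have hn0 : (0 < n)%N.
  case: n hn {nmin} => // hn; exfalso.
  have := bo_le_exp q k1; rewrite -zpowX => h; apply: h.
  by have -> : (- Posz k * Posz q = Posz 0 - Posz (k * q))%R by lia.
exists (Posz n - Posz (k * q) - 1)%R; rewrite subrK; split=> // hlt.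
have : Q n.-1.
  apply/asboolP.
  by have -> : (Posz n.-1 - Posz (k * q) = Posz n - Posz (k * q) - 1)%R by lia.
by move/nmin; lia.
Qed.

Lemma le_by_inv_nat (r s c : R) :
  (forall q : nat, (0 < q)%N -> (r <= s + c / q%:R)%R) -> (r <= s)%R.
Proof.
move=> h; rewrite leNgt; apply/negP => sr.
have d0 : (0 < r - s)%R by rewrite subr_gt0.
have [n hn] : exists n : nat, (`|c| / (r - s) < n%:R)%R.
  exists (Num.bound (`|c| / (r - s))).
  by apply: archi_boundP; rewrite divr_ge0// ltW.
have := h n.+1 isT; apply/negP; rewrite -ltNge.
rewrite -ltrBrDl ltr_pdivrMr ?ltr0n//.
move: hn; rewrite ltr_pdivrMr// => hn.
apply: (le_lt_trans (ler_norm c)); apply: (lt_trans hn).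
by rewrite mulrC ltr_pM2l// ltr_nat.
Qed.

Lemma holder_mono x y : dominated x -> dominated y -> x <=o y -> (holder x <= holder y)%R.
Proof.
move=> hx hy xy; apply: (@le_by_inv_nat _ _ 1%R) => q q0.
have [m [m1 m2]] := zpow_floor q hx.
have h1 := holder_le hx q0 (bo_ltW m2).
have h2 := holder_ge hy q0 (bo_le_trans m1 (bo_le_exp q xy)).
apply: (le_trans h1); rewrite intrD mulrDl; exact: lerD.
Qed.

(** By [bo_expM], the powers of [b] below [x ^+ q] and [y ^+ q] multiply to one
below [(x * y) ^+ q], and likewise above, so that the two sides differ by at
most [2 / q] for every [q]. *)
Lemma holderM x y : dominated x -> dominated y -> holder (x * y) = (holder x + holder y)%R.
Proof.
move=> hx hy; have hxy := dominatedM hx hy.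
have key q : (0 < q)%N -> exists m n : int,
    [/\ (m%:~R / q%:R <= holder x <= (m + 1)%:~R / q%:R)%R,
        (n%:~R / q%:R <= holder y <= (n + 1)%:~R / q%:R)%R &
        ((m + n)%:~R / q%:R <= holder (x * y) <= (m + 1 + (n + 1))%:~R / q%:R)%R].
  move=> q0.
  have [m [m1 m2]] := zpow_floor q hx; have [n [n1 n2]] := zpow_floor q hy.
  have m3 := bo_ltW m2; have n3 := bo_ltW n2.
  exists m, n; split; first by rewrite holder_ge// holder_le.
    by rewrite holder_ge// holder_le.
  have [h|h] := bo_le_total (x * y) (y * x).
    have [h1 h2] := bo_expM q h.
    rewrite holder_ge ?holder_le//.
      apply: bo_le_trans (bo_le_exp q h) _; apply: bo_le_trans h2 _.
      by rewrite addrC zpowD; apply: bo_le_mul.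
    by apply: bo_le_trans h1; rewrite zpowD; apply: bo_le_mul.
  have [h1 h2] := bo_expM q h.
  rewrite holder_ge ?holder_le//.
    by apply: bo_le_trans h2 _; rewrite zpowD; apply: bo_le_mul.
  apply: bo_le_trans (bo_le_exp q h); apply: bo_le_trans h1.
  by rewrite addrC zpowD; apply: bo_le_mul.
apply/eqP; rewrite eq_le; apply/andP; split.
  apply: (@le_by_inv_nat _ _ 2%R) => q q0.
  have [m [n [/andP[a1 a2] /andP[b1 b2] /andP[c1 c2]]]] := key q q0.
  move: a1 a2 b1 b2 c1 c2; rewrite !intrD !mulrDl; lra.
apply: (@le_by_inv_nat _ _ 2%R) => q q0.
have [m [n [/andP[a1 a2] /andP[b1 b2] /andP[c1 c2]]]] := key q q0.
move: a1 a2 b1 b2 c1 c2; rewrite !intrD !mulrDl; lra.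
Qed.

Lemma dominated_pos x k : 1 <=o x -> x <=o b ^+ k -> dominated x.
Proof.
move=> h1 h2; exists k; split=> //; apply: bo_le_trans h1.
by rewrite -[1]/(zpow b 0%R); apply: zpow_le => //; lia.
Qed.

Lemma dominated1 : dominated 1.
Proof. by exists 0%N; split; exact: (bo_irr ltB). Qed.

Lemma holder1 : holder 1 = 0%R.
Proof. by have := holderM dominated1 dominated1; rewrite mulg1; lra. Qed.

Lemma holderV x : dominated x -> holder x^-1 = (- holder x)%R.
Proof.
by move=> hx; have := holderM hx (dominatedV hx); rewrite mulgV holder1; lra.
Qed.

Lemma holder_self : holder b = 1%R.
Proof.
have hb : dominated b.
  by apply: (@dominated_pos _ 1); [exact: bo_ltW|rewrite expg1; exact: (bo_irr ltB)].
have h : zpow b 1 <=o b ^+ 1 by exact: (bo_irr ltB).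
apply/eqP; rewrite eq_le.
by have := @holder_ge b 1 1 hb isT h; have := @holder_le b 1 1 hb isT h; rewrite divr1 => -> ->.
Qed.

Lemma holder_eq0_lt x n : dominated x -> holder x = 0%R -> x ^+ n <o b.
Proof.
move=> hx p0; apply: contrapT => h.
have n0 : (0 < n)%N by case: n h => // /(_ b_gt1).
have h1 : zpow b 1 <=o x ^+ n by rewrite /= expg1.
by have := holder_ge hx n0 h1; rewrite p0 leNgt divr_gt0// ltr0n.
Qed.

Lemma holder_eq0_negligible x : dominated x -> holder x = 0%R -> negligible lt x b.
Proof.
move=> hx p0 n; split; apply: holder_eq0_lt => //; first exact: dominatedV.
by rewrite holderV// p0 oppr0.
Qed.

(** The length is additive with values in an abelian group, hence vanishes on
commutators; and an element of length zero is negligible against the unit. *)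
Lemma commutator_negligible x y : dominated x -> dominated y ->
  negligible lt (x * y * x^-1 * y^-1) b.
Proof.
move=> hx hy; have hx' := dominatedV hx; have hy' := dominatedV hy.
apply: holder_eq0_negligible; first by do !apply: dominatedM.
rewrite !holderM//; do ?[exact: dominatedM|do !apply: dominatedM => //].
by rewrite !holderV//; lra.
Qed.

End BiOrder.

Local Open Scope order_scope.
Local Open Scope group_scope.

(** * Groups acting on a complete ordered line *)

Definition is_lub d (X : orderType d) (S : set X) (s : X) :=
  (forall x, S x -> x <= s) /\ (forall u, (forall x, S x -> x <= u) -> s <= u).

(** The order structure shared by the real line and its open rays. *)
Record line d (X : orderType d) : Prop := {
  line_inh : exists x : X, True;
  line_nomax : forall x : X, exists y, x < y;
  line_nomin : forall x : X, exists y, y < x;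
  line_sup : forall S : set X, S !=set0 ->
    (exists u, forall x, S x -> x <= u) -> exists s, is_lub S s }.

Record acts (Gam : groupType) d (X : orderType d) (act : Gam -> X -> X) : Prop := {
  act1 : forall x, act 1 x = x;
  actM : forall f g x, act (f * g) x = act f (act g x);
  act_homo : forall f x y, x < y -> act f x < act f y }.

Section Action.
Variables (Gam : groupType) (d : Order.disp_t) (X : orderType d).
Variables (act : Gam -> X -> X) (lineX : line X) (actsX : acts act).
Local Notation "f • x" := (act f x) (at level 25, right associativity).
Implicit Types (f g b : Gam) (x y z : X).

Definition at_most_two_fixed : Prop := forall f x y z,
  x < y -> y < z -> f • x = x -> f • y = y -> f • z = z -> f = 1.

(** There is no global fixed point. *)
Definition moves_all (H : set Gam) := forall x, exists2 g, H g & g • x <> x.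

Lemma actK f x : f^-1 • f • x = x.
Proof. by rewrite -(actM actsX) mulVg (act1 actsX). Qed.

Lemma actKV f x : f • f^-1 • x = x.
Proof. by rewrite -(actM actsX) mulgV (act1 actsX). Qed.

Lemma act_lt f x y : (f • x < f • y) = (x < y).
Proof.
apply/idP/idP => [/(act_homo actsX f^-1)|]; last exact: act_homo.
by rewrite !actK.
Qed.

Lemma act_le f x y : (f • x <= f • y) = (x <= y).
Proof. by rewrite !leNgt act_lt. Qed.

Lemma act_inj f x y : f • x = f • y -> x = y.
Proof. by move/(congr1 (act f^-1)); rewrite !actK. Qed.

Lemma fixV f x : f • x = x -> f^-1 • x = x.
Proof. by move=> h; rewrite -{1}h actK. Qed.

Lemma act_ltV f x y : (f^-1 • x < y) = (x < f • y).
Proof. by rewrite -(act_lt f) actKV. Qed.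

Lemma lt_actV f x y : (x < f^-1 • y) = (f • x < y).
Proof. by rewrite -(act_lt f) actKV. Qed.

Lemma actS f n x : (f ^+ n.+1) • x = f • (f ^+ n) • x.
Proof. by rewrite expgS (actM actsX). Qed.

Lemma fixX f n x : f • x = x -> (f ^+ n) • x = x.
Proof.
by move=> h; elim: n => [|n IH]; [rewrite expg0 (act1 actsX)|rewrite actS IH].
Qed.

Lemma act_geX f n x : x <= f • x -> x <= (f ^+ n) • x.
Proof.
move=> h; elim: n => [|n IH]; first by rewrite expg0 (act1 actsX).
by rewrite actS; apply: (le_trans h); rewrite act_le.
Qed.

Lemma act_gtX f n x : x < f • x -> (0 < n)%N -> x < (f ^+ n) • x.
Proof.
case: n => // n h _; rewrite actS; apply: (lt_le_trans h).
by rewrite act_le; exact/act_geX/ltW.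
Qed.

Lemma act_leX f n x : f • x <= x -> (f ^+ n) • x <= x.
Proof.
move=> h; elim: n => [|n IH]; first by rewrite expg0 (act1 actsX).
by rewrite actS; apply: (le_trans _ h); rewrite act_le.
Qed.

Lemma act_ltX f n x : f • x < x -> (0 < n)%N -> (f ^+ n) • x < x.
Proof.
case: n => // n h _; rewrite actS; apply: (le_lt_trans _ h).
by rewrite act_le; exact/act_leX/ltW.
Qed.

Lemma inf_exists (S : set X) : S !=set0 ->
    (exists u, forall x, S x -> u <= x) ->
  exists s, (forall x, S x -> s <= x) /\ (forall u, (forall x, S x -> u <= x) -> u <= s).
Proof.
move=> [x Sx] lbS.
have [||s [s1 s2]] := @line_sup _ _ lineX [set u | forall x, S x -> u <= x].
- by [].
- by exists x => u; apply.
exists s; split=> // y Sy; apply: s2 => u; exact.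
Qed.

(** The agreement point is the supremum of the points of [[x, y]] where [f] is at
most [g]; if the two values differed there, the preimage under [f] of the value
of [g] would contradict the supremum. *)
Lemma crossing f g x y : x < y -> f • x < g • x -> g • y < f • y ->
  exists z, [/\ x < z, z < y & f • z = g • z].
Proof.
move=> xy fgx gfy.
pose S := [set t | t <= y /\ f • t <= g • t].
have [||s [s1 s2]] := @line_sup _ _ lineX S.
- by exists x; split; exact: ltW.
- by exists y => t [].
have sy : s <= y by apply: s2 => t [].
have key t : f • t < g • t -> t < y -> exists t', t < t' /\ S t'.
  move=> h ty; pose w := f^-1 • g • t.
  have tw : t < w by rewrite lt_actV.
  have fw : f • w = g • t by rewrite actKV.
  have wy : w < y by rewrite -(act_lt f) fw (lt_trans _ gfy)// act_lt.
  exists w; split=> //; split; first exact: ltW.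
  by rewrite fw act_le ltW.
have xs : x < s.
  by have [t' [xt' St']] := key x fgx xy; exact: (lt_le_trans xt' (s1 _ St')).
have fs : f • s = g • s.
  case: (ltgtP (f • s) (g • s)) => // h; exfalso.
    have sy' : s < y.
      by rewrite lt_neqAle sy andbT; apply/eqP => e; move: h; rewrite e ltNge ltW.
    have [t' [st' St']] := key s h sy'.
    by move: st'; rewrite ltNge s1.
  pose w := f^-1 • g • s.
  have ws : w < s by rewrite act_ltV.
  suff : s <= w by rewrite leNgt ws.
  apply: s2 => t St; rewrite leNgt; apply/negP => wt.
  have : g • s < f • t by rewrite -(actKV f (g • s)) act_lt.
  rewrite ltNge (le_trans St.2)// act_le; exact: s1.
exists s; split=> //; rewrite lt_neqAle sy andbT; apply/eqP => e.
by move: gfy; rewrite -e fs ltxx.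
Qed.

(** A bounded orbit would have a supremum, which [f] cannot move. *)
Lemma iter_up f y w : (forall z, y <= z -> z < f • z) ->
  exists n, w < (f ^+ n) • y.
Proof.
move=> h; apply: contrapT => hn.
pose S := [set z | exists n, z = (f ^+ n) • y].
have [||s [s1 s2]] := @line_sup _ _ lineX S.
- by exists y, 0%N; rewrite expg0 (act1 actsX).
- by exists w => _ [n ->]; rewrite leNgt; apply/negP => ?; apply: hn; exists n.
have ys : y <= s by apply: s1; exists 0%N; rewrite expg0 (act1 actsX).
have sfs := h s ys.
suff : s <= f^-1 • s by rewrite leNgt act_ltV sfs.
apply: s2 => _ [n ->]; rewrite leNgt act_ltV; apply/negP => lt.
have : (f ^+ n.+1) • y <= s by apply: s1; exists n.+1.
by rewrite actS leNgt lt.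
Qed.

Lemma iter_down f y w : (forall z, z <= y -> f • z < z) ->
  exists n, (f ^+ n) • y < w.
Proof.
move=> h; apply: contrapT => hn.
pose S := [set z | exists n, z = (f ^+ n) • y].
have [||s [s1 s2]] := @inf_exists S.
- by exists y, 0%N; rewrite expg0 (act1 actsX).
- by exists w => _ [n ->]; rewrite leNgt; apply/negP => ?; apply: hn; exists n.
have ys : s <= y by apply: s1; exists 0%N; rewrite expg0 (act1 actsX).
have sfs := h s ys.
suff : f^-1 • s <= s by rewrite leNgt lt_actV sfs.
apply: s2 => _ [n ->]; rewrite leNgt lt_actV; apply/negP => lt.
have : s <= (f ^+ n.+1) • y by apply: s1; exists n.+1.
by rewrite actS leNgt lt.
Qed.

Record subgroup (H : set Gam) : Prop := {
  sub1 : H 1; subM : forall f g, H f -> H g -> H (f * g);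
  subV : forall f, H f -> H f^-1 }.

(** The supremum of a bounded orbit would be a global fixed point. *)
Lemma orbit_up (H : set Gam) x y : subgroup H -> moves_all H ->
  exists2 g, H g & y < g • x.
Proof.
move=> sH mH; apply: contrapT => hn.
pose S := [set z | exists2 g, H g & z = g • x].
have [||s [s1 s2]] := @line_sup _ _ lineX S.
- by exists x, 1; [exact: sub1|rewrite (act1 actsX)].
- by exists y => _ [g Hg ->]; rewrite leNgt; apply/negP => ?; apply: hn; exists g.
have le_s g : H g -> s <= g • s.
  move=> Hg; apply: s2 => _ [k Hk ->]; rewrite -(act_le g^-1) actK -(actM actsX).
  by apply: s1; exists (g^-1 * k) => //; apply: (subM sH) => //; exact: subV.
have [g Hg] := mH s; apply; apply/eqP; rewrite eq_le le_s// andbT.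
by rewrite -(act_le g^-1) actK le_s//; exact: subV.
Qed.

(** Comparison of germs at +oo. *)
Definition ltoo f g : Prop := exists y0, forall y, y0 <= y -> f • y < g • y.
Local Notation "f <o g" := (ltoo f g) (at level 70).

Lemma crossing_oo f g x : g • x < f • x -> f <o g ->
  exists z, x < z /\ f • z = g • z.
Proof.
move=> gfx [y0 h].
have [y ym] := line_nomax lineX (Order.max x y0).
have xy : x < y by apply: le_lt_trans ym; rewrite le_max lexx.
have y0y : y0 <= y by apply/ltW; apply: le_lt_trans ym; rewrite le_max lexx orbT.
by have [z [xz _ e]] := crossing xy gfx (h _ y0y); exists z.
Qed.

Hypothesis few : at_most_two_fixed.

Lemma agree3 f g x y z : x < y -> y < z ->
  f • x = g • x -> f • y = g • y -> f • z = g • z -> f = g.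
Proof.
move=> xy yz ex ey ez.
have e t : f • t = g • t -> (g^-1 * f) • t = t by move=> h; rewrite (actM actsX) h actK.
have /(congr1 (fun k => g * k)) := few xy yz (e _ ex) (e _ ey) (e _ ez).
by rewrite mulVKg mulg1.
Qed.

(** Distinct elements agree at most twice, so they are eventually ordered. *)
Lemma ltoo_total f g : f <> g -> f <o g \/ g <o f.
Proof.
move=> fg.
have [y0 hy0] : exists y0, forall y, y0 <= y -> f • y <> g • y.
  apply: contrapT => hn.
  have A y0 : exists2 y, y0 <= y & f • y = g • y.
    apply: contrapT => h; apply: hn; exists y0 => y y0y e; apply: h.
    by exists y.
  have [x0 _] := line_inh lineX.
  have [x _ ex] := A x0.
  have [x' xx'] := line_nomax lineX x; have [y x'y ey] := A x'.
  have [y' yy'] := line_nomax lineX y; have [z y'z ez] := A y'.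
  by apply: fg; apply: (@agree3 f g x y z) => //; apply: lt_le_trans; eassumption.
have half f1 f2 : (forall y, y0 <= y -> f1 • y <> f2 • y) ->
    f1 • y0 < f2 • y0 -> f1 <o f2.
  move=> h lt0; exists y0 => y y0y; rewrite ltNge; apply/negP => le.
  have lt' : f2 • y < f1 • y.
    by rewrite lt_neqAle le andbT; apply/eqP => e; apply: (h y).
  have y0y' : y0 < y.
    by rewrite lt_neqAle y0y andbT; apply/eqP => e; move: lt0; rewrite e ltNge ltW.
  by have [z [z1 _ /h]] := crossing y0y' lt0 lt'; apply; exact: ltW.
case: (ltgtP (f • y0) (g • y0)) => h.
- by left; exact: half.
- by right; apply: half => // y hy e; exact: (hy0 y).
- by case: (hy0 y0).
Qed.

(** Every element is increasing and preserves the neighbourhoods of +oo, whence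
the invariance on both sides. *)
Lemma ltoo_biorder : biorder ltoo.
Proof.
split.
- by move=> f [y /(_ y (lexx y))]; rewrite ltxx.
- move=> f g h [y h1] [z h2]; exists (Order.max y z) => t.
  by rewrite ge_max => /andP[a1 a2]; exact: (lt_trans (h1 _ a1) (h2 _ a2)).
- exact: ltoo_total.
- by move=> k f g [y h]; exists y => t yt; rewrite !(actM actsX) act_lt h.
- move=> k f g [y h]; exists (k^-1 • y) => t yt; rewrite !(actM actsX); apply: h.
  by rewrite -(act_le k^-1) actK.
Qed.

End Action.

(** * Elements with fixed points and their negligible elements *)

Section Hulls.
Variables (R : realType) (Gam : groupType) (d : Order.disp_t) (X : orderType d).
Variables (act : Gam -> X -> X) (lineX : line X) (actsX : acts act).
Hypothesis few : at_most_two_fixed act.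
Local Notation "f • x" := (act f x) (at level 25, right associativity).
Local Notation "f <o g" := (ltoo act f g) (at level 70).
Implicit Types (f g b : Gam) (x y z p q : X).

Let ltB : biorder (ltoo act) := ltoo_biorder lineX actsX few.

(** The outer dynamics of an element with fixed points that is positive at +oo;
[p] and [q] are its extreme fixed points, possibly equal.  For [s = false] it
is expanding, as an affine map of ratio larger than 1; for [s = true] it moves
both ends to the right, and will be called parabolic. *)
Record hull (s : bool) f p q : Prop := {
  hull_le : p <= q;
  hull_fixl : f • p = p;
  hull_fixr : f • q = q;
  hull_right : forall y, q < y -> y < f • y;
  hull_left : forall y, y < p -> if s then y < f • y else f • y < y }.

Definition typed (s : bool) f := exists p q, hull s f p q.

Lemma hull_gt1 s f p q : hull s f p q -> 1 <o f.
Proof.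
move=> h; have [y qy] := line_nomax lineX q.
by exists y => z yz; rewrite (act1 actsX) (hull_right h)// (lt_le_trans qy).
Qed.

Lemma typed_gt1 s f : typed s f -> 1 <o f.
Proof. by move=> [p [q /hull_gt1]]. Qed.

Lemma hullJ s f p q g : hull s f p q -> hull s (g * f * g^-1) (g • p) (g • q).
Proof.
move=> [h1 h2 h3 h4 h5]; split.
- by rewrite act_le.
- by rewrite !(actM actsX) actK// h2.
- by rewrite !(actM actsX) actK// h3.
- move=> y qy; rewrite !(actM actsX) -(act_ltV actsX g); apply: h4.
  by rewrite (lt_actV actsX g).
- move=> y yp; have : g^-1 • y < p by rewrite (act_ltV actsX g).
  move/h5; case: (s); rewrite !(actM actsX).
    by rewrite -(act_ltV actsX g).
  by rewrite -(lt_actV actsX g).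
Qed.

Lemma typedJ s f g : typed s f -> typed s (g * f * g^-1).
Proof. by move=> [p [q h]]; exists (g • p), (g • q); exact: hullJ. Qed.

Lemma fix3 f x y z : f <> 1 ->
  x < y -> y < z -> f • x = x -> f • y = y -> f • z = z -> False.
Proof. by move=> f1 xy yz fx fy fz; apply: f1; exact: (few xy yz). Qed.

Lemma max_fixed f x : f <> 1 -> f • x = x ->
  exists q, f • q = q /\ forall y, q < y -> f • y <> y.
Proof.
move=> f1 fx; have [[y [xy fy]]|h] := pselect (exists y, x < y /\ f • y = y).
  by exists y; split=> // z yz fz; exact: (fix3 f1 xy yz).
by exists x; split=> // y xy fy; apply: h; exists y.
Qed.

Lemma min_fixed f x : f <> 1 -> f • x = x ->
  exists p, f • p = p /\ forall y, y < p -> f • y <> y.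
Proof.
move=> f1 fx; have [[y [xy fy]]|h] := pselect (exists y, y < x /\ f • y = y).
  by exists y; split=> // z yz fz; exact: (fix3 f1 yz xy).
by exists x; split=> // y xy fy; apply: h; exists y.
Qed.

Lemma typed_cases f x : f • x = x -> 1 <o f -> typed true f \/ typed false f.
Proof.
move=> fx f_gt1.
have f1 : f <> 1 by move=> e; move: f_gt1; rewrite e; exact: (bo_irr ltB).
have [q [fq qmax]] := max_fixed f1 fx; have [p [fp pmin]] := min_fixed f1 fx.
have pq : p <= q by rewrite leNgt; apply/negP => /pmin.
have right y : q < y -> y < f • y.
  move=> qy; case: (ltgtP y (f • y)) => // h; last by case: (qmax y).
  have h' : f • y < 1 • y by rewrite (act1 actsX).
  have [z [yz]] := crossing_oo lineX actsX h' f_gt1.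
  by rewrite (act1 actsX) => e; case: (qmax z) => //; exact: (lt_trans qy).
have [left|] := pselect (forall y, y < p -> f • y < y).
  by right; exists p, q.
move=> /existsNP[y1 /not_implyP[y1p /negP]]; rewrite -leNgt => y1f.
have {}y1f : y1 < f • y1.
  by rewrite lt_neqAle y1f andbT; apply/eqP => e; exact: (pmin _ y1p).
left; exists p, q; split=> // y yp.
case: (ltgtP y (f • y)) => // h; last by case: (pmin y).
exfalso; case: (ltgtP y y1) => yy1.
- have [||z [_ z2]] := @crossing _ _ _ _ lineX actsX f 1 y y1 yy1; rewrite ?(act1 actsX)//.
  by move=> e; apply: (pmin z) => //; exact: (lt_trans z2).
- have [||z [_ z2]] := @crossing _ _ _ _ lineX actsX 1 f y1 y yy1; rewrite ?(act1 actsX)//.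
  by move=> e; apply: (pmin z) => //; exact: (lt_trans z2).
- by move: h; rewrite yy1 ltNge ltW.
Qed.

Lemma hull_fixXl s f p q n : hull s f p q -> (f ^+ n) • p = p.
Proof. by move=> h; apply: (fixX actsX); exact: hull_fixl h. Qed.

Lemma hull_fixXr s f p q n : hull s f p q -> (f ^+ n) • q = q.
Proof. by move=> h; apply: (fixX actsX); exact: hull_fixr h. Qed.

Lemma fixVX f n x : f • x = x -> (f^-1 ^+ n) • x = x.
Proof. by move=> h; apply/(fixX actsX)/(fixV actsX). Qed.

(** A high power of [f] overtakes [b] somewhere to the right of both hulls.  If it
were nevertheless smaller than [b] at +oo, the two would meet there twice; but
they already meet once between the hulls, which makes three. *)
Lemma parabolic_lt_exp f b pf qf pb qb :
  hull true f pf qf -> hull true b pb qb -> qb < pf -> exists n, b <o f ^+ n.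
Proof.
move=> hf hb sep; have [y qfy] := line_nomax lineX qf.
have qbqf : qb < qf by exact: (lt_le_trans sep (hull_le hf)).
have [n fny] : exists n, b • y < (f ^+ n) • y.
  apply: (iter_up lineX actsX) => z yz.
  by apply: (hull_right hf); exact: (lt_le_trans qfy).
have n0 : (0 < n)%N.
  case: n fny => //; rewrite expg0 (act1 actsX) ltNge ltW// (hull_right hb)//.
  exact: (lt_trans qbqf).
have at_qb : b • qb < (f ^+ n) • qb.
  by rewrite (hull_fixr hb) (act_gtX actsX)// (hull_left hf).
have at_pf : (f ^+ n) • pf < b • pf by rewrite (hull_fixXl _ hf) (hull_right hb).
have at_qf : (f ^+ n) • qf < b • qf by rewrite (hull_fixXr _ hf) (hull_right hb).
exists n; apply: contrapT => hn.
have ne : f ^+ n <> b by move=> e; move: at_qb; rewrite e ltxx.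
have {hn} lt : f ^+ n <o b by case: (ltoo_total lineX actsX few ne).
have [z1 [_ z1b e1]] := crossing lineX actsX sep at_qb at_pf.
have [z2 [z2a z2b e2]] := crossing lineX actsX qfy at_qf fny.
have [z3 [z3a e3]] := crossing_oo lineX actsX fny lt.
apply: ne; apply: (@agree3 _ _ _ _ actsX few _ _ z1 z2 z3) => //.
  by apply: (lt_trans z1b); exact: (le_lt_trans (hull_le hf)).
exact: (lt_trans z2b).
Qed.

(** The same count for the inverses: near -oo a high power of [b^-1] goes below
[f^-1], which forces a meeting to the left of both hulls, besides the one
between the hulls and the one near +oo. *)
Lemma parabolic_exp_gt f b pf qf pb qb :
  hull true f pf qf -> hull true b pb qb -> qb < pf -> exists m, f <o b ^+ m.
Proof.
move=> hf hb sep; have [x xpb] := line_nomin lineX pb.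
have xpf : x < pf by apply: (lt_trans xpb); exact: (le_lt_trans (hull_le hb)).
have [m bmx] : exists m, (b^-1 ^+ m) • x < f^-1 • x.
  apply: (iter_down lineX actsX) => z zx.
  by rewrite (act_ltV actsX); apply: (hull_left hb); exact: (le_lt_trans zx).
have m0 : (0 < m)%N.
  case: m bmx => //; rewrite expg0 (act1 actsX) ltNge ltW// (act_ltV actsX).
  exact: (hull_left hf).
have lefts y : y < pf -> f^-1 • y < y.
  by move=> h; rewrite (act_ltV actsX); exact: (hull_left hf).
have rights y : qb < y -> (b^-1 ^+ m) • y < y.
  by move=> h; apply: (act_ltX actsX) => //; rewrite (act_ltV actsX) (hull_right hb).
have fixb := fixVX m (hull_fixr hb); have fixbl := fixVX m (hull_fixl hb).
have at_pb : f^-1 • pb < (b^-1 ^+ m) • pb.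
  by rewrite fixbl lefts// (le_lt_trans (hull_le hb)).
have at_qb : f^-1 • qb < (b^-1 ^+ m) • qb by rewrite fixb lefts.
have at_pf : (b^-1 ^+ m) • pf < f^-1 • pf.
  by rewrite (fixV actsX (hull_fixl hf)) rights.
have at_qf : (b^-1 ^+ m) • qf < f^-1 • qf.
  by rewrite (fixV actsX (hull_fixr hf)) rights// (lt_le_trans sep (hull_le hf)).
exists m; apply: contrapT => hn.
have ne : f^-1 <> b^-1 ^+ m by move=> e; move: at_qb; rewrite e ltxx.
have lt : f^-1 <o b^-1 ^+ m.
  rewrite expVgn; apply: (bo_ltV ltB).
  by case: (@ltoo_total _ _ _ _ lineX actsX few (b ^+ m) f) => // e; apply: ne;
    rewrite expVgn e.
have [z1 [_ z1b e1]] := crossing lineX actsX xpb bmx at_pb.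
have [z2 [z2a z2b e2]] := crossing lineX actsX sep at_qb at_pf.
have [z3 [z3a e3]] := crossing_oo lineX actsX at_qf lt.
apply: ne; apply: (@agree3 _ _ _ _ actsX few _ _ z1 z2 z3) => //.
  by apply: (lt_trans z1b); exact: (le_lt_trans (hull_le hb)).
by apply: (lt_trans z2b); exact: (le_lt_trans (hull_le hf)).
Qed.

Section NoParabolic.
Variables (K : set Gam) (subK : subgroup K).
Hypothesis noP : forall e, K e -> ~ typed true e.

Lemma subX f n : K f -> K (f ^+ n).
Proof.
move=> Kf; elim: n => [|n IH]; first exact: (sub1 subK).
by rewrite expgS; exact: (subM subK).
Qed.

Lemma agree_fix f g z : f • z = g • z -> (f^-1 * g) • z = z.
Proof. by move=> e; rewrite (actM actsX) -e actK. Qed.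

(** Without parabolic elements, the quotient [f^-1 * g], which is positive at +oo
and has fixed points, has to be expanding, and this decides its sign to the
left of its fixed points. *)
Lemma two_agree_left f g x z1 z2 : K f -> K g -> f <o g -> x < z1 -> z1 < z2 ->
  f • z1 = g • z1 -> f • z2 = g • z2 -> f • x <> g • x -> g • x < f • x.
Proof.
move=> Kf Kg lt xz1 z12 e1 e2 ne.
have e_gt1 : 1 <o f^-1 * g by rewrite -(mulVg f); exact: (bo_mull ltB).
have e_ne1 : f^-1 * g <> 1 by move=> e; move: e_gt1; rewrite e; exact: (bo_irr ltB).
have f1 := agree_fix e1; have f2 := agree_fix e2.
have [tt|[p [q h]]] := typed_cases f1 e_gt1.
  by case: (noP _ tt); apply: (subM subK) => //; exact: (subV subK).
have xp : x < p.
  rewrite ltNge; apply/negP; rewrite le_eqVlt => /orP[/eqP px|px].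
    by apply: ne; have := hull_fixl h; rewrite px (actM actsX) => /(congr1 (act f));
      rewrite actKV.
  by apply: (fix3 e_ne1 (lt_trans px xz1) z12) => //; exact: (hull_fixl h).
by have := hull_left h xp; rewrite (actM actsX) (act_ltV actsX).
Qed.

(** A high power of [f] overtakes [b] to the right of its own hull; if it were
smaller at +oo, the two would meet twice there, and [two_agree_left] would give
the wrong order at the right end of the hull of [f]. *)
Lemma expanding_lt_exp f b pf qf pb qb : K f -> K b ->
  hull false f pf qf -> hull false b pb qb -> qb < pf -> exists n, b <o f ^+ n.
Proof.
move=> Kf Kb hf hb sep; have [y qfy] := line_nomax lineX qf.
have qbqf : qb < qf by exact: (lt_le_trans sep (hull_le hf)).
have [n fny] : exists n, b • y < (f ^+ n) • y.
  apply: (iter_up lineX actsX) => z yz.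
  by apply: (hull_right hf); exact: (lt_le_trans qfy).
have at_qf : (f ^+ n) • qf < b • qf by rewrite (hull_fixXr _ hf) (hull_right hb).
exists n; apply: contrapT => hn.
have ne : f ^+ n <> b by move=> e; move: at_qf; rewrite e ltxx.
have {hn} lt : f ^+ n <o b by case: (ltoo_total lineX actsX few ne).
have [z1 [z1a z1b e1]] := crossing lineX actsX qfy at_qf fny.
have [z2 [z2a e2]] := crossing_oo lineX actsX fny lt.
suff : b • qf < (f ^+ n) • qf by rewrite ltNge ltW.
apply: (@two_agree_left _ _ _ z1 z2) => //; first exact: subX.
  exact: (lt_trans z1b).
by move=> e; move: at_qf; rewrite e ltxx.
Qed.

(** A high power of [b] goes below [f] to the left of both hulls, hence meets it
there; if it were smaller at +oo, they would meet again on the right, against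
[two_agree_left]. *)
Lemma expanding_exp_gt f b pf qf pb qb : K f -> K b ->
  hull false f pf qf -> hull false b pb qb -> qb < pf -> exists m, f <o b ^+ m.
Proof.
move=> Kf Kb hf hb sep; have [x xpb] := line_nomin lineX pb.
have pbpf : pb < pf by exact: (le_lt_trans (hull_le hb)).
have xpf : x < pf by exact: (lt_trans xpb).
have qbqf : qb < qf by exact: (lt_le_trans sep (hull_le hf)).
have [m bmx] : exists m, (b ^+ m) • x < f • x.
  apply: (iter_down lineX actsX) => z zx.
  by apply: (hull_left hb); exact: (le_lt_trans zx).
have m0 : (0 < m)%N.
  by case: m bmx => //; rewrite expg0 (act1 actsX) ltNge ltW// (hull_left hf).
have at_pb : f • pb < (b ^+ m) • pb.
  by rewrite (hull_fixXl _ hb) (hull_left hf).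
have at_qf : f • qf < (b ^+ m) • qf.
  by rewrite (hull_fixr hf) (act_gtX actsX)// (hull_right hb).
exists m; apply: contrapT => hn.
have ne : b ^+ m <> f by move=> e; move: at_qf; rewrite e ltxx.
have {hn} lt : b ^+ m <o f by case: (ltoo_total lineX actsX few ne).
have [z1 [z1a z1b e1]] := crossing lineX actsX xpb bmx at_pb.
have [z2 [z2a e2]] := crossing_oo lineX actsX at_qf lt.
suff : f • x < (b ^+ m) • x by rewrite ltNge ltW.
apply: (@two_agree_left _ _ _ z1 z2) => //; first exact: subX.
  apply: (lt_trans z1b); apply: (lt_trans pbpf).
  by apply: (le_lt_trans _ z2a); exact: hull_le hf.
by move=> e; move: bmx; rewrite e ltxx.
Qed.

End NoParabolic.

Section NegligibleSubgroup.
Variables (s : bool) (K : set Gam) (subK : subgroup K) (mK : moves_all act K).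
Hypothesis comparable : forall f b pf qf pb qb, K f -> K b ->
  hull s f pf qf -> hull s b pb qb -> qb < pf ->
  (exists n, b <o f ^+ n) /\ (exists m, f <o b ^+ m).

(** Quantifying over all elements of the given type, rather than fixing one, makes
the normality of this subgroup immediate. *)
Definition infinitesimals : set Gam :=
  [set f | K f /\ forall e, K e -> typed s e -> negligible (ltoo act) f e].

(** A conjugate of [e] far to the right has a hull disjoint from those of both [b]
and [e], and the comparison goes through it. *)
Lemma typed_comparable b e : K b -> K e -> typed s b -> typed s e ->
  exists n, b <o e ^+ n.
Proof.
move=> Kb Ke [pb [qb hb]] [pe [qe he]].
have [g Kg hg] := orbit_up lineX actsX pe (Order.max qb qe) subK mK.
move: hg; rewrite gt_max => /andP[sepb sepe].
have Kg' : K (g * e * g^-1).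
  by apply: (subM subK); [exact: (subM subK)|exact: (subV subK)].
have hg := hullJ g he.
have [[n lt1] _] := comparable Kg' Kb hg hb sepb.
have [_ [m lt2]] := comparable Kg' Ke hg he sepe.
exists (m * n)%N; rewrite expgnA; apply: (bo_lt_le_trans ltB lt1).
exact/(bo_le_exp ltB)/(bo_ltW ltB).
Qed.

Lemma infinitesimals_sub : infinitesimals `<=` K. Proof. by move=> f []. Qed.

Lemma infinitesimals_subgroup : subgroup infinitesimals.
Proof.
split.
- split; first exact: (sub1 subK).
  by move=> e Ke te; apply: negligible1; exact: (typed_gt1 te).
- move=> f g [Kf hf] [Kg hg]; split; first exact: (subM subK).
  by move=> e Ke te; apply: (negligibleM ltB); [exact: hf|exact: hg].
- move=> f [Kf hf]; split; first exact: (subV subK).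
  by move=> e Ke te; apply: negligibleV; exact: hf.
Qed.

Lemma infinitesimals_untyped f : infinitesimals f -> ~ typed s f.
Proof.
move=> [Kf hf] tf; have [h _] := hf f Kf tf 1%N.
by move: h; rewrite expg1; exact: (bo_irr ltB).
Qed.

Lemma infinitesimals_normal g : (forall k, K k -> K (g * k * g^-1)) ->
  (forall k, K k -> K (g^-1 * k * g)) ->
  forall f, infinitesimals f -> infinitesimals (g * f * g^-1).
Proof.
move=> n1 n2 f [Kf hf]; split=> [|e Ke te]; first exact: n1.
have -> : e = g * (g^-1 * e * g) * g^-1 by rewrite !mulgA mulgV mul1g mulgK.
apply: (negligibleJ ltB); apply: hf; first exact: n2.
by rewrite -{2}(invgK g); exact: typedJ.
Qed.

(** All elements of the type lie in one Archimedean class, so the commutator of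
[b] with a conjugate is negligible.  It is not trivial when the hull of the
conjugate lies to the right: the two elements would commute, and [b] moves the
right end of that hull further right, where the conjugate fixes nothing. *)
Lemma infinitesimals_nontrivial b : K b -> typed s b -> exists2 c, infinitesimals c & c <> 1.
Proof.
move=> Kb tb; have [p [q h]] := tb.
have [g Kg sep] := orbit_up lineX actsX p q subK mK.
set b' := g * b * g^-1.
have Kb' : K b' by apply: (subM subK); [exact: (subM subK)|exact: (subV subK)].
have h' : hull s b' (g • p) (g • q) := hullJ g h.
have tb' : typed s b' by exact: typedJ.
have b1 := typed_gt1 tb; have b'1 := typed_gt1 tb'.
have dom (x : Gam) : K x -> typed s x -> dominated (ltoo act) b x.
  move=> Kx tx; have [n lt] := typed_comparable Kx Kb tx tb.
  apply: (@dominated_pos _ _ ltB _ b1 _ n); last exact: (bo_ltW ltB).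
  by apply: (bo_ltW ltB); exact: typed_gt1 tx.
have neg : negligible (ltoo act) (b' * b * b'^-1 * b^-1) b.
  by apply: (commutator_negligible ltB R b1); exact: dom.
exists (b' * b * b'^-1 * b^-1).
  split; first by do !apply: (subM subK) => //; exact: (subV subK).
  move=> e Ke te; have [n lt] := typed_comparable Kb Ke tb te.
  have key (x : Gam) : (forall j, x ^+ j <o b) -> forall j, x ^+ j <o e.
    move=> hx j; apply: contrapT => hj.
    have := bo_lt_le_trans ltB lt (@bo_le_exp _ _ ltB _ _ n hj).
    rewrite -expgnA => lt2; exact: (bo_irr ltB (bo_trans ltB lt2 (hx _))).
  by move=> j; split; apply: key => i; case: (neg i).
move=> /divg1_eq e.
have {}e : b' * b = b * b' by rewrite -{2}e mulgVK.
have q1 : q < g • q by apply: (lt_le_trans sep); rewrite (act_le actsX) (hull_le h).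
have q2 := hull_right h q1.
have := hull_right h' q2; rewrite -(actM actsX b' b) e (actM actsX b) (hull_fixr h').
by rewrite ltxx.
Qed.

End NegligibleSubgroup.

Definition is_normal (D : set Gam) := forall g f, D f -> D (g * f * g^-1).

Definition acts_freely (D : set Gam) := forall f x, D f -> f • x = x -> f = 1.

Lemma normalV (D : set Gam) g f : is_normal D -> D f -> D (g^-1 * f * g).
Proof. by move=> nD Df; rewrite -{2}(invgK g); exact: nD. Qed.

(** The global fixed points of a normal subgroup form an invariant set, which is
unbounded as soon as it has one point. *)
Lemma normal_moves_all (D : set Gam) k : moves_all act setT -> is_normal D -> D k ->
  k <> 1 -> moves_all act D.
Proof.
move=> mG nD Dk k1 x; apply: contrapT => hn.
have subT : subgroup (@setT Gam) by [].
have fixD g : k • g • x = g • x.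
  apply/(act_inj actsX (f := g^-1)); rewrite actK// -!(actM actsX).
  by apply: contrapT => ne; apply: hn; exists (g^-1 * k * g) => //; exact: normalV.
have [g1 _ h1] := orbit_up lineX actsX x x subT mG.
have [g2 _ h2] := orbit_up lineX actsX x (g1 • x) subT mG.
apply: k1; apply: (few h1 h2) => //.
by have := fixD 1; rewrite (act1 actsX).
Qed.

Lemma untyped_free (D : set Gam) : subgroup D -> (forall s f, D f -> ~ typed s f) ->
  acts_freely D.
Proof.
move=> sD ut f x Df fx; apply: contrapT => f1.
have key g : D g -> g • x = x -> 1 <o g -> False.
  by move=> Dg gx /(typed_cases gx)[]; exact: ut.
case: (ltoo_total lineX actsX few f1) => h.
  apply: (key f^-1); [exact: (subV sD)|exact: (fixV actsX)|].
  exact: (bo_lt1V ltB).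
exact: (key f).
Qed.

(** The elements negligible against all parabolic ones contain no parabolic
element; among them, those negligible against the expanding ones can be neither
parabolic nor expanding. *)
Lemma exists_free_normal : moves_all act setT ->
  (exists g x, g <> 1 /\ g • x = x) ->
  exists D, [/\ subgroup D, is_normal D, acts_freely D & exists2 t, D t & t <> 1].
Proof.
move=> mG [g0 [x0 [g01 g0x]]].
have subT : subgroup (@setT Gam) by [].
have [K [sK nK K1 noP]] : exists K, [/\ subgroup K, is_normal K,
    exists2 t, K t & t <> 1 & forall e, K e -> ~ typed true e].
  have [[b tb]|noP] := pselect (exists b, typed true b); last first.
    exists setT; split=> //; first by exists g0.
    by move=> e _ te; apply: noP; exists e.
  have cmp f b0 pf qf pb qb : setT f -> setT b0 ->
      hull true f pf qf -> hull true b0 pb qb -> qb < pf ->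
      (exists n, b0 <o f ^+ n) /\ (exists m, f <o b0 ^+ m).
    move=> _ _ h1 h2 h3; split; first exact: (parabolic_lt_exp h1 h2).
    exact: (parabolic_exp_gt h1 h2).
  exists (infinitesimals true setT); split.
  - exact: infinitesimals_subgroup.
  - by move=> g; exact: infinitesimals_normal.
  - exact: (infinitesimals_nontrivial subT mG cmp (b := b)).
  - exact: infinitesimals_untyped.
have [[b [Kb tb]]|noE] := pselect (exists b, K b /\ typed false b); last first.
  exists K; split=> //; apply: untyped_free => // -[] e Ke; first exact: noP.
  by move=> te; apply: noE; exists e.
have [t Kt t1] := K1.
have mK := normal_moves_all mG nK Kt t1.
have cmp f b0 pf qf pb qb : K f -> K b0 ->
    hull false f pf qf -> hull false b0 pb qb -> qb < pf ->
    (exists n, b0 <o f ^+ n) /\ (exists m, f <o b0 ^+ m).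
  move=> Kf Kb0 h1 h2 h3; split; first exact: (expanding_lt_exp sK noP Kf Kb0 h1 h2).
  exact: (expanding_exp_gt sK noP Kf Kb0 h1 h2).
exists (infinitesimals false K); split.
- exact: infinitesimals_subgroup.
- move=> g; apply: infinitesimals_normal => k Kk; first exact: nK.
  exact: normalV.
- apply: untyped_free => [|[] e]; first exact: infinitesimals_subgroup.
    by move=> /infinitesimals_sub /noP.
  exact: infinitesimals_untyped.
- exact: (infinitesimals_nontrivial sK mK cmp Kb tb).
Qed.

End Hulls.

(** * Freely acting subgroups are abelian *)

Section FreeSubgroup.
Variables (R : realType) (Gam : groupType) (d : Order.disp_t) (X : orderType d).
Variables (act : Gam -> X -> X) (lineX : line X) (actsX : acts act).
Hypothesis few : at_most_two_fixed act.
Variables (D : set Gam) (subD : subgroup D) (freeD : acts_freely act D).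
Local Notation "f • x" := (act f x) (at level 25, right associativity).
Local Notation "f <o g" := (ltoo act f g) (at level 70).
Implicit Types (f g s t : Gam) (x y z : X).

Let ltB : biorder (ltoo act) := ltoo_biorder lineX actsX few.

Lemma free_gt1 t x : D t -> x < t • x -> 1 <o t.
Proof.
move=> Dt h.
have t1 : t <> 1 by move=> e; move: h; rewrite e (act1 actsX) ltxx.
exists x => y; rewrite le_eqVlt => /orP[/eqP <-|xy]; rewrite (act1 actsX)//.
case: (ltgtP y (t • y)) => // ty; last by case: t1; exact: (freeD Dt (esym ty)).
have [||z [_ _ e]] := @crossing _ _ _ _ lineX actsX 1 t x y xy; rewrite ?(act1 actsX)//.
by case: t1; apply: (freeD Dt (x := z)); rewrite -e (act1 actsX).
Qed.

Lemma gt1_free t x : D t -> 1 <o t -> x < t • x.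
Proof.
move=> Dt h; case: (ltgtP x (t • x)) => // tx; exfalso.
  have h' : 1 <o t^-1.
    by apply: (free_gt1 (x := x)); [exact: (subV subD)|rewrite (lt_actV actsX)].
  have := bo_ltV ltB h'; rewrite invgK invg1 => h2.
  exact: (bo_irr ltB (bo_trans ltB h h2)).
by move: h; rewrite (freeD Dt (esym tx)); exact: (bo_irr ltB).
Qed.

(** For a free action, the order at +oo is visible at any single point. *)
Lemma free_ltP s t x : D s -> D t -> (s <o t) <-> (s • x < t • x).
Proof.
move=> Ds Dt; have Dst : D (s^-1 * t) by apply: (subM subD) => //; exact: (subV subD).
have e : (s <o t) <-> (1 <o s^-1 * t).
  split=> [/(bo_mull ltB (s^-1 : Gam))|/(bo_mull ltB s)]; first by rewrite mulVg.
  by rewrite mulg1 mulVKg.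
rewrite -(lt_actV actsX) -(actM actsX).
by split=> [/e/gt1_free-/(_ x)|/(free_gt1 Dst)/e//]; exact.
Qed.

(** The orbits of [t] are unbounded, so one of its powers passes [s] at a point. *)
Lemma free_archimedean s t : D s -> D t -> 1 <o t -> exists n, s <o t ^+ n.
Proof.
move=> Ds Dt t1; have [x _] := line_inh lineX.
have [n hn] : exists n, s • x < (t ^+ n) • x.
  by apply: (iter_up lineX actsX) => z _; exact: gt1_free.
by exists n; apply/(@free_ltP _ _ x Ds (subX subD n Dt)).
Qed.

Lemma free_not_negligible s t : D s -> D t -> 1 <o t -> negligible (ltoo act) s t -> s = 1.
Proof.
move=> Ds Dt t1 hs; apply: contrapT => s1.
have key (u : Gam) : D u -> 1 <o u -> (forall n, u ^+ n <o t) -> False.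
  move=> Du u1 hu; have [n hn] := free_archimedean Dt Du u1.
  exact: (bo_irr ltB (bo_trans ltB hn (hu n))).
case: (ltoo_total lineX actsX few s1) => h.
  apply: (key s^-1) => [|| n]; [exact: (subV subD)|exact: (bo_lt1V ltB)|].
  by case: (hs n).
by apply: (key s) => // n; case: (hs n).
Qed.

Lemma free_dominated t s : D t -> 1 <o t -> D s -> dominated (ltoo act) t s.
Proof.
move=> Dt t1 Ds; case: (bo_le_total ltB 1 s) => h.
  have [n hn] := free_archimedean Ds Dt t1.
  exact: (dominated_pos ltB t1 h (bo_ltW ltB hn)).
have [n hn] := free_archimedean (subV subD Ds) Dt t1.
rewrite -(invgK s); apply: (dominatedV ltB); apply: (dominated_pos ltB t1 _ (bo_ltW ltB hn)).
by move/(bo_leV ltB) : h; rewrite invg1.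
Qed.

(** Hölder's theorem: commutators are negligible, and an Archimedean order leaves
no room for nontrivial negligible elements. *)
Lemma free_abelian s t : D s -> D t -> s * t = t * s.
Proof.
move=> Ds Dt; have [->|t1] := pselect (t = 1); first by rewrite mulg1 mul1g.
wlog t_gt1 : t Dt t1 / 1 <o t.
  move=> hw; case: (ltoo_total lineX actsX few t1) => h; last exact: hw.
  have e : s * t^-1 = t^-1 * s.
    apply: hw; [exact: (subV subD)| |exact: (bo_lt1V ltB)].
    by move=> e; apply: t1; rewrite -(invgK t) e invg1.
  by rewrite -[in RHS](mulgVK t s) e !mulgA mulgV mul1g.
have Dc : D (s * t * s^-1 * t^-1) by do !apply: (subM subD) => //; exact: (subV subD).
have := commutator_negligible ltB R t_gt1 (free_dominated Dt t_gt1 Ds)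
  (free_dominated Dt t_gt1 Dt).
move/(free_not_negligible Dc Dt t_gt1)/divg1_eq => e.
by rewrite -[in RHS]e mulgVK.
Qed.

End FreeSubgroup.

(** * The coordinate in which a free normal subgroup acts by translations *)

Section TranslationCoordinate.
Variables (R : realType) (Gam : groupType) (d : Order.disp_t) (X : orderType d).
Variables (act : Gam -> X -> X) (lineX : line X) (actsX : acts act).
Hypothesis few : at_most_two_fixed act.
Variables (D : set Gam) (subD : subgroup D) (normalD : is_normal D) (freeD : acts_freely act D).
Local Notation "f • x" := (act f x) (at level 25, right associativity).
Local Notation "f <o g" := (ltoo act f g) (at level 70).
Implicit Types (f g s t : Gam) (x y z : X).

Let ltB : biorder (ltoo act) := ltoo_biorder lineX actsX few.

Variables (t0 : Gam) (Dt0 : D t0) (t0_gt1 : 1 <o t0).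
Variables (g0 : Gam) (x0 : X) (g0_ne1 : g0 <> 1) (g0x0 : g0 • x0 = x0).

(** The translation length, normalised by [t0]. *)
Definition tau : Gam -> R := holder (ltoo act) R t0.

Let dom s : D s -> dominated (ltoo act) t0 s.
Proof. exact: (free_dominated lineX actsX few subD freeD Dt0 t0_gt1). Qed.

Lemma tauM s t : D s -> D t -> tau (s * t) = (tau s + tau t)%R.
Proof. by move=> Ds Dt; apply: (holderM ltB); [|exact: dom|exact: dom]. Qed.

Lemma tauV s : D s -> tau s^-1 = (- tau s)%R.
Proof. by move=> Ds; apply: (holderV ltB); [|exact: dom]. Qed.

Lemma tau_t0 : tau t0 = 1%R. Proof. exact: (holder_self ltB). Qed.

Lemma tau_eq0 s : D s -> tau s = 0%R -> s = 1.
Proof.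
move=> Ds h; apply: (free_not_negligible lineX actsX few subD freeD Ds Dt0 t0_gt1).
exact: (holder_eq0_negligible ltB t0_gt1 (dom Ds) h).
Qed.

Lemma tau_inj s t : D s -> D t -> tau s = tau t -> s = t.
Proof.
move=> Ds Dt h; apply/divg1_eq/tau_eq0; first by apply: (subM subD) => //; exact: (subV subD).
by rewrite tauM ?tauV//; [rewrite h subrr|exact: (subV subD)].
Qed.

Lemma tau_lt s t x : D s -> D t -> (tau s < tau t)%R = (s • x < t • x).
Proof.
move=> Ds Dt; apply/idP/idP => h.
  apply/(free_ltP lineX actsX few subD freeD x Ds Dt).
  apply: contrapT => hn; move: h; rewrite ltNge; apply/negP; rewrite negbK.
  by apply: (holder_mono ltB R t0_gt1 _ _ hn); exact: dom.
have {}h : s <o t by apply/(free_ltP lineX actsX few subD freeD x Ds Dt).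
rewrite lt_neqAle; apply/andP; split.
  by apply/eqP => /(tau_inj Ds Dt) e; move: h; rewrite e; exact: (bo_irr ltB).
by apply: (holder_mono ltB R t0_gt1 _ _ (bo_ltW ltB h)); exact: dom.
Qed.

Lemma tau_le s t x : D s -> D t -> (tau s <= tau t)%R = (s • x <= t • x).
Proof. by move=> Ds Dt; rewrite !leNgt (tau_lt x Dt Ds). Qed.

Lemma Dzpow t (m : int) : D t -> D (zpow t m).
Proof.
move=> Dt; case: m => n; first exact: (subX subD).
exact/(subX subD)/(subV subD).
Qed.

Lemma additive_zpow (sg : Gam -> R) t (m : int) :
  (forall s u, D s -> D u -> sg (s * u) = (sg s + sg u)%R) -> D t ->
  sg (zpow t m) = (m%:~R * sg t)%R.
Proof.
move=> sgM Dt.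
have sg1 : sg 1 = 0%R by have := sgM 1 1 (sub1 subD) (sub1 subD); rewrite mulg1; lra.
have sgV u : D u -> sg u^-1 = (- sg u)%R.
  by move=> Du; have := sgM _ _ Du (subV subD Du); rewrite mulgV sg1; lra.
elim/int_ind: m => [|n IH|n IH]; first by rewrite mul0r.
  have -> : Posz n.+1 = (Posz n + 1)%R by lia.
  rewrite zpow_succ sgM//; last exact: (Dzpow (Posz n)).
  by rewrite IH intrD mulrDl mul1r.
have -> : (- (Posz n.+1))%R = ((- Posz n) - 1)%R by lia.
rewrite zpow_pred sgM//; [|exact: Dzpow|exact: (subV subD)].
by rewrite IH sgV// intrD mulrDl mulrN1z mulN1r.
Qed.

Lemma tau_zpow t (m : int) : D t -> tau (zpow t m) = (m%:~R * tau t)%R.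
Proof. by apply: additive_zpow; exact: tauM. Qed.

Lemma tau1 : tau 1 = 0%R. Proof. exact: (holder1 ltB). Qed.

Lemma tau_gt0 t x : D t -> (0 < tau t)%R = (x < t • x).
Proof. by move=> Dt; rewrite -tau1 (tau_lt x (sub1 subD) Dt) (act1 actsX). Qed.

Lemma tau_gt1 t : D t -> (0 < tau t)%R -> forall x, x < t • x.
Proof. by move=> Dt h x; rewrite -tau_gt0. Qed.

(** An element commuting with [t] fixes the whole [t]-orbit of its fixed points. *)
Lemma not_fixed_orbit g t x : g <> 1 -> g • x = x -> (forall y, y < t • y) ->
  g * t = t * g -> False.
Proof.
move=> g1 gx ht e.
have step y : g • y = y -> g • t • y = t • y.
  by move=> gy; rewrite -(actM actsX) e (actM actsX) gy.
exact: (fix3 few g1 (ht x) (ht (t • x)) gx (step _ gx) (step _ (step _ gx))).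
Qed.

(** A least positive element of the normal subgroup would be preserved by
conjugation, thus commute with [g0], which fixes a point. *)
Lemma tau_conj_least t : D t -> (0 < tau t)%R ->
  exists2 s, D s & (0 < tau s < tau t)%R.
Proof.
move=> Dt t_gt; apply: contrapT => hn.
have least s : D s -> (0 < tau s)%R -> (tau t <= tau s)%R.
  by move=> Ds hs; rewrite leNgt; apply/negP => lt; apply: hn; exists s => //; rewrite hs lt.
have pos_conj g : (0 < tau (g * t * g^-1))%R.
  rewrite (tau_gt0 (g • x0)) ?(actM actsX); last exact: normalD.
  by rewrite actK// act_lt// tau_gt1.
have Dg g : D (g * t * g^-1) by exact: normalD.
suff e : g0 * t * g0^-1 = t.
  apply: (not_fixed_orbit g0_ne1 g0x0 (tau_gt1 Dt t_gt)).
  by rewrite -[in RHS]e mulgVK.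
apply: tau_inj => //; apply/eqP; rewrite eq_le; apply/andP; split; last exact: least.
have le x := tau_le x (Dg g0^-1) Dt.
have := least _ (Dg g0^-1) (pos_conj _).
have D1 := Dg (g0^-1); have D2 := Dg g0.
rewrite (tau_le (g0^-1 • x0) Dt D1) invgK !(actM actsX) actKV// => h1.
rewrite (tau_le (g0 • x0) D2 Dt) !(actM actsX) actK//.
by rewrite g0x0 -(act_le actsX g0^-1) actK//; move: h1; rewrite (fixV actsX g0x0).
Qed.

(** Otherwise the positive translation lengths would have a least element. *)
Lemma tau_small (e : R) : (0 < e)%R -> exists2 t, D t & (0 < tau t < e)%R.
Proof.
move=> e0; pose S := [set r : R | exists t, [/\ D t, (0 < tau t)%R & r = tau t]].
have S1 : S 1%R by exists t0; rewrite tau_t0; split=> //; exact: ltr01.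
have infS : has_inf S.
  by split; [exists 1%R|exists 0%R => _ [t [_ /ltW h ->]]].
have [i0|ipos] := pselect (inf S <= 0)%R.
  have [_ [t [Dt ht ->]] lt] := @inf_adherent _ S e e0 infS.
  by exists t => //; rewrite ht (lt_le_trans lt)//; move: i0; lra.
have {}ipos : (0 < inf S)%R by rewrite ltNge; apply/negP.
exfalso.
have [_ [t [Dt ht ->]] lt] := @inf_adherent _ S _ ipos infS.
have [s Ds /andP[s0 st]] := tau_conj_least Dt ht.
have Du : D (t * s^-1) by apply: (subM subD) => //; exact: (subV subD).
have tu : tau (t * s^-1) = (tau t - tau s)%R by rewrite tauM ?tauV//; exact: (subV subD).
have is_ : (inf S <= tau s)%R by apply: (ge_inf infS.2); exists s.
have iu : (inf S <= tau (t * s^-1))%R.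
  by apply: (ge_inf infS.2); exists (t * s^-1); split=> //; rewrite tu subr_gt0.
by move: lt is_ iu; rewrite tu; lra.
Qed.

Lemma tau_approx (c e : R) : (0 < e)%R -> exists2 t, D t & (c - e < tau t < c)%R.
Proof.
move=> e0; have [|t Dt /andP[t1 t2]] := @tau_small (e / 2)%R; first by lra.
pose n := Num.floor ((c - e / 2) / tau t)%R.
exists (zpow t n); first exact: Dzpow.
rewrite tau_zpow//.
have h1 : (n%:~R * tau t <= c - e / 2)%R.
  by rewrite -ler_pdivlMr// ge_floor.
have h2 : (c - e / 2 < (n%:~R + 1) * tau t)%R.
  by rewrite -ltr_pdivrMr// -(intrD _ n 1) floorD1_gt.
by apply/andP; split; move: h1 h2 t2; lra.
Qed.

(** The map that sends [t • x0] to [tau t] on the orbit of [x0], extended to the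
line by monotonicity. *)
Definition tcoord x : R := sup [set r | exists t, [/\ D t, t • x0 <= x & r = tau t]].

Let t0_move x : x < t0 • x.
Proof. by apply: tau_gt1 => //; rewrite tau_t0 ltr01. Qed.

Lemma coord_has_sup x : has_sup [set r | exists t, [/\ D t, t • x0 <= x & r = tau t]].
Proof.
split.
  have [n hn] : exists n, (t0^-1 ^+ n) • x0 < x.
    by apply: (iter_down lineX actsX) => z _; rewrite (act_ltV actsX).
  exists (tau (t0^-1 ^+ n)), (t0^-1 ^+ n); split=> //; last exact: ltW.
  exact/(subX subD)/(subV subD).
have [n hn] : exists n, x < (t0 ^+ n) • x0.
  by apply: (iter_up lineX actsX) => z _.
exists (tau (t0 ^+ n)) => _ [t [Dt tx ->]].
by rewrite (tau_le x0)//; [exact/ltW/(le_lt_trans tx)|exact: (subX subD)].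
Qed.

Lemma coord_ge t x : D t -> t • x0 <= x -> (tau t <= tcoord x)%R.
Proof. by move=> Dt h; apply: (sup_upper_bound (coord_has_sup x)); exists t. Qed.

Lemma coord_mono x y : x <= y -> (tcoord x <= tcoord y)%R.
Proof.
move=> xy; apply: sup_le_ub; first by case: (coord_has_sup x).
by move=> _ [t [Dt tx ->]]; apply: coord_ge => //; exact: (le_trans tx).
Qed.

Lemma coord_lt x y : (tcoord x < tcoord y)%R -> x < y.
Proof. by rewrite !ltNge; apply: contra; exact: coord_mono. Qed.

Lemma coordD s x : D s -> tcoord (s • x) = (tcoord x + tau s)%R.
Proof.
have half t y : D t -> (tcoord (t • y) <= tcoord y + tau t)%R.
  move=> Dt; apply: sup_le_ub; first by case: (coord_has_sup (t • y)).
  move=> _ [u [Du uy ->]]; rewrite -lerBlDr.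
  have -> : (tau u - tau t = tau (t^-1 * u))%R.
    by rewrite tauM ?tauV//; [lra|exact: (subV subD)].
  apply: coord_ge; first by apply: (subM subD) => //; exact: (subV subD).
  by rewrite (actM actsX) -(act_le actsX t) actKV.
move=> Ds; apply/eqP; rewrite eq_le half//=.
have := half _ (s • x) (subV subD Ds); rewrite actK// tauV//; lra.
Qed.

Lemma coord_gt (c : R) x : exists n : int, (c < tcoord ((zpow t0 n) • x))%R.
Proof.
exists (Num.floor (c - tcoord x) + 1)%R; rewrite coordD; last exact: Dzpow.
by rewrite tau_zpow// tau_t0 mulr1 -ltrBlDl floorD1_gt.
Qed.

Lemma coord_smaller (c : R) x : exists n : int, (tcoord ((zpow t0 n) • x) < c)%R.
Proof.
exists (Num.floor (c - tcoord x) - 1)%R; rewrite coordD; last exact: Dzpow.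
rewrite tau_zpow// tau_t0 mulr1 -ltrBrDl intrD.
by have := ge_floor (c - tcoord x)%R; lra.
Qed.

(** On the subgroup, [sg] is an increasing additive function, hence proportional to
[tau]; and a subgroup element of length close to the difference of two
coordinates compares the values of [k - a * tcoord] at the two points. *)
Lemma coord_unique (k : X -> R) (sg : Gam -> R) :
  (forall x y, x <= y -> (k x <= k y)%R) ->
  (forall t x, D t -> k (t • x) = (k x + sg t)%R) ->
  exists a b, (0 <= a)%R /\ forall x, k x = (a * tcoord x + b)%R.
Proof.
move=> k_mono kD; pose a := sg t0.
have a0 : (0 <= a)%R.
  by have := k_mono _ _ (ltW (t0_move x0)); rewrite kD// /a; lra.
have sgM s u : D s -> D u -> sg (s * u) = (sg s + sg u)%R.
  move=> Ds Du; have := kD _ x0 (subM subD Ds Du).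
  by rewrite (actM actsX) kD// kD//; lra.
have sg_le s t : D s -> D t -> ~ t <o s -> (sg s <= sg t)%R.
  move=> Ds Dt h; have : s • x0 <= t • x0.
    by rewrite leNgt; apply/negP => /(free_ltP lineX actsX few subD freeD x0 Dt Ds).
  by move/k_mono; rewrite !kD//; lra.
have sgE s : D s -> sg s = (a * tau s)%R.
  move=> Ds.
  have sgX q : sg (s ^+ q) = (q%:R * sg s)%R by exact: (additive_zpow (Posz q) sgM Ds).
  have key q : (0 < q)%N -> exists m : int,
      (m%:~R / q%:R * a <= sg s <= (m%:~R / q%:R + q%:R^-1) * a /\
       m%:~R / q%:R <= tau s <= m%:~R / q%:R + q%:R^-1)%R.
    move=> q0; have [m [m1 m2]] := zpow_floor ltB t0_gt1 q (dom Ds).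
    have qR : (0 < q%:R :> R)%R by rewrite ltr0n.
    have m3 := bo_ltW ltB m2.
    have l1 := sg_le _ _ (Dzpow m Dt0) (subX subD q Ds) m1.
    have l2 := sg_le _ _ (subX subD q Ds) (Dzpow (m + 1)%R Dt0) m3.
    exists m; split; last first.
      have := holder_ge ltB R t0_gt1 (dom Ds) q0 m1.
      have := holder_le ltB R t0_gt1 (dom Ds) q0 m3.
      by rewrite intrD mulrDl mul1r => -> ->.
    move: l1 l2; rewrite !(additive_zpow _ sgM Dt0) sgX -/a intrD => l1 l2.
    apply/andP; split; first by rewrite mulrAC ler_pdivrMr// [leRHS]mulrC.
    rewrite (_ : (_ + _) * a = (m%:~R + 1%:~R) * a / q%:R)%R; last first.
      by rewrite mulrAC; congr (_ * _)%R; rewrite mulrDl mulr1z mul1r.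
    by rewrite ler_pdivlMr// mulrC.
  apply/eqP; rewrite eq_le; apply/andP; split; apply: (@le_by_inv_nat _ _ _ a) => q q0.
    have [m [/andP[h1 h2] /andP[h3 h4]]] := key q q0.
    have := ler_wpM2l a0 h3; move: h2; lra.
  have [m [/andP[h1 h2] /andP[h3 h4]]] := key q q0.
  have := ler_wpM2l a0 h4; move: h1; lra.
have dle x y : (k x - a * tcoord x <= k y - a * tcoord y)%R.
  apply: (@le_by_inv_nat _ _ _ a) => q q0.
  have q1 : (0 < q%:R^-1 :> R)%R by rewrite invr_gt0 ltr0n.
  have [t Dt /andP[t1 t2]] := tau_approx (tcoord y - tcoord x) q1.
  have : (tcoord (t • x) < tcoord y)%R by rewrite coordD//; move: t2; lra.
  move=> /coord_lt/ltW/k_mono; rewrite kD// sgE// => h.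
  by have := ler_wpM2l a0 (ltW t1); move: h; lra.
exists a, (k x0 - a * tcoord x0)%R; split=> // x.
by have := dle x x0; have := dle x0 x; lra.
Qed.

(** Precomposition with [g] is again a monotone equivariant function, because the
subgroup is normal. *)
Lemma coord_affine g : exists a b, (0 < a)%R /\
  forall x, tcoord (g • x) = (a * tcoord x + b)%R.
Proof.
have [||a [b [a0 ab]]] := @coord_unique (fun x => tcoord (g • x))
    (fun t => tau (g * t * g^-1)).
- by move=> x y xy; apply: coord_mono; rewrite act_le.
- move=> t x Dt; rewrite -coordD; last exact: normalD.
  by rewrite !(actM actsX) actK.
exists a, b; split=> //; rewrite lt_neqAle a0 andbT; apply/eqP => e.
have := ab (g^-1 • t0 • x0); have := ab (g^-1 • x0).
rewrite !actKV// (@coordD t0 x0 Dt0) tau_t0 -e; lra.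
Qed.

(** The identity together with the elements without fixed points.  It does not
mention the subgroup [D] and is preserved by every homeomorphism normalising
the group, including the decreasing ones. *)
Definition fixfree : set Gam := [set g | forall x, g • x = x -> g = 1].

(** If the ratio of [g] in the coordinate is not 1, then [g] fixes the supremum of
the points whose coordinate is below the fixed coordinate.  Conversely, an
element of ratio 1 commutes with [t0], and then has no fixed point unless it is
trivial. *)
Lemma fixfreeP g : fixfree g <-> exists b, forall x, tcoord (g • x) = (tcoord x + b)%R.
Proof.
split=> [Tg|[b hb] x gx].
  have [a [b [a0 ab]]] := coord_affine g.
  have [a1|a1] := pselect (a = 1%R).
    by exists b => x; rewrite ab a1 mul1r.
  have a1' : (1 - a != 0)%R by apply/eqP; move: a1; lra.
  (* The fixed point of the affine map induced by [g]. *)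
  pose c := (b / (1 - a))%R.
  have cE : (a * c + b = c)%R by rewrite /c; field.
  have S_g x : (tcoord (g • x) < c)%R = (tcoord x < c)%R.
    by rewrite ab -[in LHS]cE ltrD2r ltr_pM2l.
  have [||s [s1 s2]] := @line_sup _ _ lineX [set x | (tcoord x < c)%R].
  - by have [n hn] := coord_smaller c x0; exists ((zpow t0 n) • x0).
  - have [n hn] := coord_gt c x0; exists ((zpow t0 n) • x0) => x xc.
    by apply/ltW/coord_lt; exact: (lt_trans xc).
  suff gs : g • s = s by exists 0%R => x; rewrite (Tg _ gs) (act1 actsX) addr0.
  apply/eqP; rewrite eq_le; apply/andP; split.
    rewrite -(act_le actsX g^-1) actK//; apply: s2 => x xc.
    by rewrite -(act_le actsX g) actKV//; apply: s1; rewrite /= S_g.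
  apply: s2 => x xc; rewrite -(act_le actsX g^-1) actK//; apply: s1.
  by rewrite /= -S_g actKV.
apply: contrapT => g1.
have b0 : b = 0%R by have := hb x; rewrite gx; lra.
suff e : g * t0 * g^-1 = t0.
  apply: (not_fixed_orbit g1 gx t0_move).
  by rewrite -[in RHS]e mulgVK.
have Dg : D (g * t0 * g^-1) by exact: normalD.
apply: tau_inj => //.
have := coordD x Dg; rewrite -{1}gx !(actM actsX) actK// hb coordD//; lra.
Qed.

Lemma fixfree_subgroup : subgroup fixfree.
Proof.
split.
- by move=> x _.
- move=> f g /fixfreeP[b hb] /fixfreeP[c hc]; apply/fixfreeP.
  by exists (c + b)%R => x; rewrite (actM actsX) hb hc addrA.
- move=> f Tf x /(fixV actsX); rewrite invgK => /Tf ->; exact: invg1.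
Qed.

End TranslationCoordinate.

(** * The group of translations *)

Section Translations.
Variables (R : realType) (Gam : groupType) (d : Order.disp_t) (X : orderType d).
Variables (act : Gam -> X -> X) (lineX : line X) (actsX : acts act).
Hypothesis few : at_most_two_fixed act.
Local Notation "f • x" := (act f x) (at level 25, right associativity).
Local Notation "f <o g" := (ltoo act f g) (at level 70).

Lemma fixfree_normal : is_normal (fixfree act).
Proof.
move=> g f Tf x; rewrite !(actM actsX) => e.
have /Tf -> : f • g^-1 • x = g^-1 • x by apply: (act_inj actsX (f := g)); rewrite e actKV.
by rewrite mulg1 mulgV.
Qed.

Lemma fixfree_free : acts_freely act (fixfree act).
Proof. by move=> f x Tf; exact: Tf. Qed.

Lemma positive_element (D : set Gam) t : subgroup D -> D t -> t <> 1 ->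
  exists2 s, D s & 1 <o s.
Proof.
move=> sD Dt t1; have ltB := ltoo_biorder lineX actsX few.
case: (ltoo_total lineX actsX few t1) => h; last by exists t.
by exists t^-1; [exact: (subV sD)|exact: (bo_lt1V ltB)].
Qed.

(** Elements without fixed points are the translations of the coordinate, hence are
closed under composition. *)
Theorem fixfree_translations : moves_all act setT ->
  (exists g x, g <> 1 /\ g • x = x) ->
  subgroup (fixfree act) /\ exists2 t, fixfree act t & 1 <o t.
Proof.
move=> mG hfix; have [D [sD nD fD [t Dt t1]]] := exists_free_normal R lineX actsX few mG hfix.
have [g [x [g1 gx]]] := hfix.
have [s Ds s1] := positive_element sD Dt t1.
split; last by exists s => // y; exact: fD.
exact: (fixfree_subgroup R lineX actsX few sD nD fD Ds s1 g1 gx).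
Qed.

End Translations.

(** * Simultaneous actions on two lines *)

Section TwoLines.
Variables (R : realType) (Gam : groupType).
Variables (dX : Order.disp_t) (X : orderType dX) (actX : Gam -> X -> X).
Variables (dY : Order.disp_t) (Y : orderType dY) (actY : Gam -> Y -> Y).
Hypotheses (lineX : line X) (actsX : acts actX) (mX : moves_all actX setT).
Hypotheses (lineY : line Y) (actsY : acts actY) (mY : moves_all actY setT).
Hypothesis fix1X : forall f x x', actX f x = x -> actX f x' = x' -> x <> x' -> f = 1.
Hypothesis fix1Y : forall f y y', actY f y = y -> actY f y' = y' -> y <> y' -> f = 1.
Hypothesis fixXY : forall f x y, actX f x = x -> actY f y = y -> f = 1.

Lemma commute_fix d (Z : orderType d) (act : Gam -> Z -> Z) g k z : acts act ->
  g * k = k * g -> act g z = z -> act g (act k z) = act k z.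
Proof. by move=> aZ e gz; rewrite -(actM aZ) e (actM aZ) gz. Qed.

(** Suppose that [g] fixes a point of [X], and let [t] be a nontrivial translation
of [X].  Both act on [Y] without fixed points: [g] by assumption, and [t] because
its fixed point on [Y], being unique, would be shared by its conjugates and thus
be global.  So both are translations of [Y] and commute; hence [g] fixes the
[t]-orbit of its fixed point in [X]. *)
Lemma two_lines_free g x : actX g x = x -> g = 1.
Proof.
move=> gx; apply: contrapT => g1.
have fewX : at_most_two_fixed actX.
  by move=> f a b c ab _ fa fb _; apply: (fix1X fa fb) => e; move: ab; rewrite e ltxx.
have fewY : at_most_two_fixed actY.
  by move=> f a b c ab _ fa fb _; apply: (fix1Y fa fb) => e; move: ab; rewrite e ltxx.
have [|TX [t TXt t_gt1]] := fixfree_translations R lineX actsX fewX mX.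
  by exists g, x.
have t1 : t <> 1.
  by move=> e; move: t_gt1; rewrite e; exact: (bo_irr (ltoo_biorder lineX actsX fewX)).
have not_commute k : actX k x <> x -> g * k = k * g -> False.
  by move=> kx e; apply: g1; exact: (fix1X gx (commute_fix actsX e gx) (nesym kx)).
(* When the action on [Y] is free, the whole group is abelian. *)
have [[g' [y' [g'1 g'y']]]|noY] := pselect (exists g y, g <> 1 /\ actY g y = y); last first.
  have [k _ kx] := mX x; apply: (not_commute k kx).
  apply: (free_abelian R lineY actsY fewY (D := setT)) => // f y _ fy.
  by apply: contrapT => f1; apply: noY; exists f, y.
have [|TY _] := fixfree_translations R lineY actsY fewY mY; first by exists g', y'.
have TYg : fixfree actY g by move=> y gy; exact: fixXY gx gy.
have TYt : fixfree actY t.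
  move=> y ty; apply: contrapT => _; have [k _] := mY y; apply.
  have nX := fixfree_normal actsX.
  have Tu : fixfree actX (k^-1 * t * k) by exact: (normalV _ nX TXt).
  have e : t * (k^-1 * t * k) = (k^-1 * t * k) * t.
    by apply: (free_abelian R lineX actsX fewX TX (@fixfree_free _ _ _ _)).
  have uy : actY (k^-1 * t * k) y = y.
    apply: contrapT => ne; apply: t1.
    by exact: (fix1Y ty (commute_fix actsY e ty) (nesym ne)).
  have tky : actY t (actY k y) = actY k y.
    by rewrite -{2}uy !(actM actsY) actKV.
  by apply: contrapT => ne; apply: t1; exact: (fix1Y ty tky (nesym ne)).
apply: (not_commute t); first by move=> tx; apply: t1; exact: TXt tx.
by apply: (free_abelian R lineY actsY fewY TY (@fixfree_free _ _ _ _)).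
Qed.

End TwoLines.

(** * The orientation-preserving subgroup as an abstract group *)

Section PlusGroup.
Variables (R : realType) (G : set (R -> R)) (sG : is_subgroup G).

Lemma plus_idfun : plus_part G idfun.
Proof. by case: sG => sub G1 _ _; split=> //; split; [exact: sub|]. Qed.

Lemma plus_comp f g : plus_part G f -> plus_part G g -> plus_part G (f \o g).
Proof.
case: sG => sub _ GM _ [Gf [_ mf]] [Gg [_ mg]].
have Gfg := GM _ _ Gf Gg.
by split=> //; split; [exact: sub|move=> x y xy; apply: mf; exact: mg].
Qed.

Lemma plus_inverse f : plus_part G f ->
  exists2 g, plus_part G g & cancel f g /\ cancel g f.
Proof.
case: sG => sub _ _ GV [Gf [[_ [g cg [fg gf]]] mf]].
have Gg := GV _ _ Gf fg gf; exists g => //; split=> //; split; first exact: sub.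
move=> x y; apply: contraTT; rewrite -!leNgt le_eqVlt => /orP[/eqP e|/mf].
  by rewrite -(gf y) e gf.
by rewrite !gf => /ltW.
Qed.

(** The proof that [G] is a subgroup is an argument of the type because the group
structure depends on it. *)
Definition plus_group (_ : is_subgroup G) := {f : R -> R | plus_part G f}.

HB.instance Definition _ := gen_eqMixin (plus_group sG).
HB.instance Definition _ := gen_choiceMixin (plus_group sG).

Definition plus_one : plus_group sG := exist _ _ plus_idfun.

Definition plus_mul (u v : plus_group sG) : plus_group sG :=
  exist _ _ (plus_comp (svalP u) (svalP v)).

Definition plus_inv (u : plus_group sG) : plus_group sG :=
  exist _ _ (s2valP (cid2 (plus_inverse (svalP u)))).

Lemma plus_invP (u : plus_group sG) :
  cancel (sval u) (sval (plus_inv u)) /\ cancel (sval (plus_inv u)) (sval u).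
Proof. exact: (s2valP' (cid2 (plus_inverse (svalP u)))). Qed.

Lemma plus_eq (u v : plus_group sG) : (forall x, sval u x = sval v x) -> u = v.
Proof. by case: u v => [f p] [g q] /= e; apply: eq_exist; apply/funext. Qed.

Let plus_mulA : associative plus_mul. Proof. by move=> u v w; apply: plus_eq. Qed.
Let plus_mul1 : left_id plus_one plus_mul. Proof. by move=> u; apply: plus_eq. Qed.
Let plus_mulr1 : right_id plus_one plus_mul. Proof. by move=> u; apply: plus_eq. Qed.
Let plus_mulV : left_inverse plus_one plus_inv plus_mul.
Proof. by move=> u; apply: plus_eq => x; exact: (plus_invP u).1. Qed.
Let plus_mulrV : right_inverse plus_one plus_inv plus_mul.
Proof. by move=> u; apply: plus_eq => x; exact: (plus_invP u).2. Qed.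

HB.instance Definition _ := isGroup.Build (plus_group sG)
  plus_mulA plus_mul1 plus_mulr1 plus_mulV plus_mulrV.

Definition plus_act (u : plus_group sG) (x : R) : R := sval u x.

Lemma plus_acts : acts plus_act.
Proof. by split=> // u x y; case: (svalP u) => _ [_]; exact. Qed.

End PlusGroup.

Local Open Scope ring_scope.

(** * The real line and its open rays *)

Lemma line_real (R : realType) : line R.
Proof.
split; first by exists 0.
- by move=> x; exists (x + 1); rewrite ltrDl.
- by move=> x; exists (x - 1); rewrite ltrBlDr ltrDl.
- move=> S S0 [u Su]; exists (sup S); split.
    by move=> x Sx; apply: sup_upper_bound => //; split=> //; exists u.
  by move=> v Sv; apply: sup_le_ub.
Qed.

Definition part (R : realType) (P : pred R) := {x : R | P x}.
HB.instance Definition _ (R : realType) (P : pred R) := [isSub for (@sval R P) : part P -> R].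
HB.instance Definition _ (R : realType) (P : pred R) := [Choice of part P by <:].
HB.instance Definition _ (R : realType) (P : pred R) :=
  [SubChoice_isSubOrder of part P by <: with ring_display].

Section Part.
Variables (R : realType) (P : pred R).

Lemma line_part :
  (exists x, P x) ->
  (forall x y z, P x -> P z -> x <= y -> y <= z -> P y) ->
  (forall x, P x -> exists y, P y /\ x < y) ->
  (forall x, P x -> exists y, P y /\ y < x) -> line (part P).
Proof.
move=> [x0 Px0] convP upP downP; split; first by exists (exist _ x0 Px0).
- by move=> [x Px]; have [y [Py xy]] := upP x Px; exists (exist _ y Py).
- by move=> [x Px]; have [y [Py xy]] := downP x Px; exists (exist _ y Py).
move=> S [a Sa] [u Su].
pose S' := [set val x | x in S].
have [s [s1 s2]] : exists s, is_lub S' s.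
  by apply: (line_sup (line_real R)); [exists (val a), a|exists (val u) => _ [x Sx <-]; exact: Su].
have Ps : P s.
  apply: (convP (val a) _ (val u)); [exact: valP|exact: valP|by apply: s1; exists a|].
  by apply: s2 => _ [x Sx <-]; exact: Su.
exists (exist _ s Ps); split; first by move=> x Sx; apply: s1; exists x.
by move=> v Sv; apply: s2 => _ [x Sx <-]; exact: Sv.
Qed.

Variables (Gam : groupType) (act : Gam -> R -> R) (actsR : acts act).
Hypothesis invP : forall f x, P x -> P (act f x).

Definition act_part (f : Gam) (u : part P) : part P :=
  exist _ (act f (val u)) (invP f (valP u)).

Lemma acts_part : acts act_part.
Proof.
split.
- by move=> u; apply: val_inj; exact: act1.
- by move=> f g u; apply: val_inj; exact: actM.
- by move=> f u v; exact: (act_homo actsR f).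
Qed.

Lemma act_part_fix f (u : part P) : act_part f u = u <-> act f (val u) = val u.
Proof. by split=> [/(congr1 val)//|e]; apply: val_inj. Qed.

End Part.

(** * Groups with a global fixed point *)

Section GlobalFixedPoint.
Variables (R : realType) (Gam : groupType) (act : Gam -> R -> R) (actsR : acts act).
Hypothesis fix_distinct : forall f a b c, a <> b -> b <> c -> a <> c ->
  act f a = a -> act f b = b -> act f c = c -> f = 1%g.

Lemma at_most_two_fixed_distinct : at_most_two_fixed act.
Proof.
move=> f x y z xy yz; apply: fix_distinct => e.
- by move: xy; rewrite e ltxx.
- by move: yz; rewrite e ltxx.
- by move: (lt_trans xy yz); rewrite e ltxx.
Qed.

Definition ray (s : bool) (p : R) : pred R := fun x => if s then p < x else x < p.

Lemma line_ray s p : line (part (ray s p)).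
Proof.
apply: line_part; rewrite /ray; case: s.
- by exists (p + 1); rewrite ltrDl.
- by exists (p - 1); rewrite ltrBlDr ltrDl.
- by move=> x y z px _ xy _; exact: lt_le_trans xy.
- by move=> x y z _ zp _ yz; exact: le_lt_trans zp.
- by move=> x px; exists (x + 1); rewrite ltrDl ltr01 (lt_trans px)// ltrDl.
- by move=> x px; exists ((x + p) / 2); split; lra.
- by move=> x px; exists ((x + p) / 2); split; lra.
- by move=> x px; exists (x - 1); split; lra.
Qed.

Variables (p : R) (pfix : forall k, act k p = p).

Lemma ray_inv s f x : ray s p x -> ray s p (act f x).
Proof. by rewrite /ray; case: s => h; rewrite -(pfix f) (act_lt actsR). Qed.

Lemma ray_ne s x : ray s p x -> p <> x.
Proof. by move=> + e; rewrite /ray -e ltxx; case: s. Qed.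

(** If [x] is not global, then neither ray of origin [p] contains a global fixed
point, since [g] already fixes [p] and [x].  Each element has at most one fixed
point besides [p], so [two_lines_free] applies to the two rays. *)
Lemma fixed_is_global g x : g <> 1%g -> act g x = x -> forall k, act k x = x.
Proof.
move=> g1 gx; have [<-//|px] := pselect (p = x).
apply: contrapT => nx.
have [s sx] : exists s, ray s p x.
  case: (ltgtP p x) => [h|h|//]; first by exists true.
  by exists false.
have disj (u : part (ray s p)) (v : part (ray (~~ s) p)) : val u <> val v.
  case: u v => [u Pu] [v Pv] /= e; move: Pu Pv; rewrite e /ray.
  by case: (s) => /= h1 h2; move: (lt_trans h1 h2); rewrite ltxx.
have moves t : moves_all (act_part (@ray_inv t)) setT.
  move=> u; apply: contrapT => hn.
  have uglob k : act k (val u) = val u.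
    by apply: contrapT => ne; apply: hn; exists k => // /act_part_fix.
  apply: g1; apply: (@fix_distinct g p x (val u)) => //.
    by move=> e; apply: nx; rewrite e.
  exact: (ray_ne (valP u)).
have fix1 t (f : Gam) (u v : part (ray t p)) :
    act_part (@ray_inv t) f u = u -> act_part (@ray_inv t) f v = v -> u <> v -> f = 1%g.
  move=> /act_part_fix fu /act_part_fix fv uv.
  apply: (@fix_distinct f p (val u) (val v)) => //; [exact: (ray_ne (valP u))| |].
    by move=> e; apply: uv; exact: val_inj.
  exact: (ray_ne (valP v)).
apply: g1; apply: (@two_lines_free R Gam _ _ (act_part (@ray_inv s))
  _ _ (act_part (@ray_inv (~~ s))) _ _ _ _ _ _ _ _ _ g (exist _ x sx)).
- exact: line_ray.
- exact: acts_part.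
- exact: moves.
- exact: line_ray.
- exact: acts_part.
- exact: moves.
- exact: fix1.
- exact: fix1.
- move=> f u v /act_part_fix fu /act_part_fix fv.
  apply: (@fix_distinct f p (val u) (val v)) => //; first exact: (ray_ne (valP u)).
  exact: (ray_ne (valP v)).
- exact/act_part_fix.
Qed.

End GlobalFixedPoint.

Section GlobalAbelian.
Variables (R : realType) (Gam : groupType) (act : Gam -> R -> R) (actsR : acts act).
Hypothesis fix_distinct : forall f a b c, a <> b -> b <> c -> a <> c ->
  act f a = a -> act f b = b -> act f c = c -> f = 1%g.

(** To the right of the last fixed point of [f], which is global, no nontrivial
element has a fixed point. *)
Lemma global_abelian p : (forall k, act k p = p) -> forall f g : Gam, (f * g = g * f)%g.
Proof.
move=> pfix f g; have [->|f1] := pselect (f = 1%g); first by rewrite mul1g mulg1.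
have few := at_most_two_fixed_distinct fix_distinct.
have [q [fq qmax]] := max_fixed few f1 (pfix f).
have qfix := fixed_is_global actsR fix_distinct pfix f1 fq.
have aP := acts_part actsR (ray_inv actsR qfix (s := true)).
apply: (free_abelian R (line_ray true q) aP _ (D := setT)) => //.
  move=> k u v w uv vw /act_part_fix fu /act_part_fix fv /act_part_fix fw.
  exact: (few _ (val u) (val v) (val w)).
move=> k u _ /act_part_fix ku; apply: contrapT => k1.
exact: (qmax _ (valP u) (fixed_is_global actsR fix_distinct pfix k1 ku f)).
Qed.

End GlobalAbelian.

(** * Homeomorphisms of the real line *)

Section Homeomorphisms.
Variable R : realType.

Lemma homeo_mono (f : R -> R) : Homeo f ->
  {homo f : x y / x < y} \/ {homo f : x y /~ x < y}.
Proof.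
move=> [cf [g _ [fg _]]].
have [||m|m] := @itv_continuous_inj_mono R f `]-oo, +oo[.
- exact: continuous_subspaceT.
- by move=> x y _ _; exact: (can_inj fg).
- by left=> x y; apply: m; rewrite in_itv.
- by right=> x y; apply: m; rewrite in_itv.
Qed.

Lemma aff_homeo (a b : R) : a != 0 -> Homeo (fun x : R => a * x + b).
Proof.
have cont (c e : R) : continuous (fun x : R => c * x + e).
  by move=> x; apply: cvgD; [apply: cvgM; [exact: cvg_cst|exact: cvg_id]|exact: cvg_cst].
move=> a0; split; first exact: cont.
exists (fun y => a^-1 * y + (- (a^-1 * b))); first exact: cont.
by split=> x; field.
Qed.

Variables (G : set (R -> R)) (sG : is_subgroup G).

Lemma fix_distinct_of_card : at_most_fixed_points 2 G ->
  forall (f : plus_group sG) a b c, a <> b -> b <> c -> a <> c ->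
  plus_act f a = a -> plus_act f b = b -> plus_act f c = c -> f = 1%g.
Proof.
move=> hG f a b c ab bc ac fa fb fc; apply: contrapT => f1.
have f1' : sval f <> idfun by move=> e; apply: f1; apply: plus_eq => x; rewrite e.
have /pcard_leP[i] := hG (sval f) (svalP f).1 f1'.
have ine x y : x <> y -> sval f x = x -> sval f y = y -> i x <> i y.
  by move=> xy fx fy e; apply: xy; apply: (@inj _ _ _ i) e; rewrite inE.
have i2 x : sval f x = x -> (i x < 2)%N by move=> fx; exact: (@funS _ _ _ _ i x fx).
have := ine _ _ ab fa fb; have := ine _ _ bc fb fc; have := ine _ _ ac fa fc.
have := i2 _ fa; have := i2 _ fb; have := i2 _ fc; lia.
Qed.

Lemma homeo_conj (g : R -> R) (u : plus_group sG) : G g ->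
  exists v : plus_group sG, forall x, plus_act v (g x) = g (plus_act u x).
Proof.
move=> Gg; have [sub _ GM GV] := sG; have [_ [g' _ [gg' g'g]]] := sub _ Gg.
have Gg' := GV _ _ Gg gg' g'g.
have [Gu [_ mu]] := svalP u.
have Gv : G (g \o sval u \o g') by exact: GM _ _ (GM _ _ Gg Gu) Gg'.
suff Pv : plus_part G (g \o sval u \o g').
  by exists (exist _ _ Pv) => x; rewrite /plus_act /= gg'.
split=> //; split; first exact: sub.
(* Since [g] and [g'] are inverse to each other, they are both increasing or both
decreasing. *)
move=> x y xy /=; have [m|m] := homeo_mono (sub _ Gg); have [m'|m'] := homeo_mono (sub _ Gg').
- by apply/m/mu/m'.
- have := m _ _ (m' _ _ xy); rewrite !g'g => yx.
  by move: (lt_trans xy yx); rewrite ltxx.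
- have := m _ _ (m' _ _ xy); rewrite !g'g => yx.
  by move: (lt_trans xy yx); rewrite ltxx.
- by apply/m/mu/m'.
Qed.

End Homeomorphisms.

(** * The semi-conjugacy to affine maps *)

Section AffineModel.
Variables (R : realType) (G : set (R -> R)) (sG : is_subgroup G).
Local Notation Gam := (plus_group sG).
Local Notation act := (@plus_act R G sG).
Local Notation T := (fixfree act).
Hypothesis few : at_most_two_fixed act.
Hypothesis subT : subgroup T.
Variables (t0 : Gam) (Tt0 : T t0) (t0_gt1 : ltoo act 1%g t0).
Variables (g0 : Gam) (x0 : R) (g0_ne1 : g0 <> 1%g) (g0x0 : act g0 x0 = x0).

Let lineR := line_real R.
Let actsG := plus_acts sG.
Let nT : is_normal T := fixfree_normal actsG.
Let fT : acts_freely act T := @fixfree_free _ _ _ act.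

Let h : R -> R := tcoord R act T t0 x0.

Let h_mono x y : x <= y -> h x <= h y.
Proof. exact: (coord_mono R lineR actsG few subT fT Tt0 t0_gt1). Qed.

Let hD t x : T t -> h (act t x) = h x + tau R act t0 t.
Proof. exact: (coordD R lineR actsG few subT fT Tt0 t0_gt1). Qed.

Let h_t0 x : h (act t0 x) = h x + 1.
Proof. by rewrite hD// (tau_t0 R lineR actsG few t0_gt1). Qed.

(** A translation of small length moves [x] to both sides without changing its
coordinate by more than that length. *)
Lemma coord_continuous : continuous h.
Proof.
move=> x; apply/cvgrPdist_lt => e e0.
have [t Tt /andP[t_gt te]] := tau_small lineR actsG few subT nT fT Tt0 t0_gt1 g0_ne1 g0x0 e0.
have up := tau_gt1 lineR actsG few subT fT Tt0 t0_gt1 Tt t_gt.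
have xl : act t^-1%g x < x by rewrite (act_ltV actsG).
near=> y.
have yl : act t^-1%g x <= y by apply: ltW; near: y; exact: lt_nbhsr.
have yr : y <= act t x by apply: ltW; near: y; exact: lt_nbhsl.
have := h_mono yl; have := h_mono yr; rewrite !hD//; last exact: (subV subT).
rewrite (tauV R lineR actsG few subT fT Tt0 t0_gt1)// => h1 h2.
by rewrite ltr_norml; apply/andP; split; move: h1 h2 te; lra.
Unshelve. all: end_near. Qed.

Lemma coord_proper : monotone_proper h.
Proof.
split; first exact: h_mono.
- apply/cvgrNyPle => A; have [n hn] := coord_smaller lineR actsG few subT fT Tt0 t0_gt1 x0 A x0.
  near=> x; apply: le_trans (ltW hn); apply: h_mono.
  by near: x; apply: nbhs_ninfty_le; exact: num_real.
- apply/cvgryPge => A; have [n hn] := coord_gt lineR actsG few subT fT Tt0 t0_gt1 x0 A x0.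
  near=> x; apply: le_trans (ltW hn) _; apply: h_mono.
  by near: x; apply: nbhs_pinfty_ge; exact: num_real.
Unshelve. all: end_near. Qed.

(** Conjugation by [g] preserves the fixed-point-free elements, so the composite of
the coordinate with [g], or its opposite when [g] is decreasing, is a monotone
equivariant function, to which [coord_unique] applies. *)
Lemma coord_affine_homeo g : G g ->
  exists ab : R * R, ab.1 != 0 /\ forall x, h (g x) = ab.1 * h x + ab.2.
Proof.
move=> Gg; have [sub _ _ _] := sG; have [_ [g' _ [gg' g'g]]] := sub _ Gg.
have [c hc] := choice (fun u => homeo_conj u Gg).
have Tc t : T t -> T (c t).
  move=> Tt x; rewrite -(g'g x) hc => /(can_inj gg') /Tt t1.
  by apply: plus_eq => y; have := hc t (g' y); rewrite t1 /plus_act /= g'g.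
have ab_ne0 a b : (forall x, h (g x) = a * h x + b) -> a != 0.
  move=> ab; apply/eqP => a0; have := ab (g' x0); have := ab (g' (act t0 x0)).
  by rewrite !g'g h_t0 a0; lra.
have uniq := coord_unique (R := R) lineR actsG few subT nT fT Tt0 t0_gt1 g0_ne1 g0x0.
have [m|m] := homeo_mono (sub _ Gg).
  have [||a [b [_ ab]]] := uniq (h \o g) (fun t => tau R act t0 (c t)).
  - by move=> x y; rewrite le_eqVlt => /orP[/eqP ->//|/m/ltW]; exact: h_mono.
  - by move=> t x Tt /=; rewrite -hc hD//; exact: Tc.
  by exists (a, b); split=> //; exact: ab_ne0 ab.
have [||a [b [_ ab]]] := uniq (fun x => - h (g x)) (fun t => - tau R act t0 (c t)).
- move=> x y; rewrite le_eqVlt => /orP[/eqP ->//|/m/ltW/h_mono].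
  by rewrite lerN2.
- by move=> t x Tt; rewrite -hc hD ?opprD//; exact: Tc.
have ab' x : h (g x) = - a * h x + - b by have := ab x; rewrite -/h; lra.
by exists (- a, - b); split=> //; exact: ab_ne0 ab'.
Qed.

(** The coordinate takes two different values, so the affine map attached to an
element of [G] is unique; therefore the assignment is multiplicative. *)
Lemma semi_conjugate_affine :
  exists F : set (R -> R), [/\ is_subgroup F, F `<=` Aff R & semi_conjugate G F].
Proof.
have [sub G1 GM GV] := sG.
have [A hA] : exists A : (R -> R) -> R * R, forall g, G g ->
    (A g).1 != 0 /\ forall x, h (g x) = (A g).1 * h x + (A g).2.
  suff /choice[A hA] : forall g, exists ab : R * R, G g ->
      ab.1 != 0 /\ forall x, h (g x) = ab.1 * h x + ab.2 by exists A.
  move=> g; have [Gg|nGg] := pselect (G g); last by exists (0, 0).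
  by have [ab hab] := coord_affine_homeo Gg; exists ab.
pose theta (g : R -> R) : R -> R := fun y => (A g).1 * y + (A g).2.
have thetaE g x : G g -> theta g (h x) = h (g x) by move=> /hA[_ ->].
have aff_eq (a b a' b' : R) : (forall x, a * h x + b = a' * h x + b') ->
    forall y, a * y + b = a' * y + b'.
  move=> e y; have e1 := e x0; have := e (act t0 x0); rewrite h_t0 => e2.
  have aa : a = a' by lra.
  by move: e1; rewrite aa => e1; lra.
have thetaM f g : G f -> G g -> theta (f \o g) = theta f \o theta g.
  move=> Gf Gg; apply/funext => y; rewrite /theta /= mulrDr mulrA -addrA.
  apply: aff_eq => x; have := thetaE _ x (GM _ _ Gf Gg); rewrite /theta => ->.
  by rewrite /= -thetaE// -thetaE// /theta; lra.
have theta1 : theta idfun = idfun.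
  apply/funext => y; rewrite -[RHS]/(y : R) -[RHS](mul1r y) -[RHS]addr0.
  by apply: aff_eq => x; have := thetaE _ x G1; rewrite /theta mul1r addr0.
exists (theta @` G); split.
- split.
  + by move=> _ [g Gg <-]; apply: aff_homeo; case: (hA g Gg).
  + by exists idfun.
  + by move=> _ _ [f Gf <-] [g Gg <-]; exists (f \o g); [exact: GM|exact: thetaM].
  + move=> _ k [g Gg <-] gk kg; have [_ [g' _ [gg' g'g]]] := sub _ Gg.
    have Gg' := GV _ _ Gg gg' g'g; exists g' => //.
    apply/funext => y; rewrite -[in LHS](kg y).
    rewrite -[LHS]/((theta g' \o theta g) (k y)) -thetaM//.
    have -> : g' \o g = idfun by exact/funext.
    by rewrite theta1.
- by move=> _ [g Gg <-]; have [a0 _] := hA g Gg; exists (A g).1, (A g).2.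
- exists theta, h; split=> //.
  + exact: coord_continuous.
  + exact: coord_proper.
  + by move=> g Gg; apply/funext => x /=; exact: thetaE.
Qed.

End AffineModel.

Local Open Scope classical_set_scope.

Theorem theorem1 (R : realType) (G : set (R -> R))
    (G_subgroup : is_subgroup G) (G_fix : at_most_fixed_points 2 G) :
  (is_abelian (plus_part G) /\
   (forall (g : R -> R) (x : R), plus_part G g -> g <> idfun ->
      fixed_points g x -> global_fixed_point (plus_part G) x)) \/
  (exists F : set (R -> R),
      [/\ is_subgroup F, F `<=` Aff R & semi_conjugate G F]).
Proof.
pose act := @plus_act R G G_subgroup.
have fix3 := fix_distinct_of_card G_fix (sG := G_subgroup).
have few := at_most_two_fixed_distinct fix3.
have actsG := plus_acts G_subgroup.
have abel : (forall f g : plus_group G_subgroup, (f * g = g * f)%g) ->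
    is_abelian (plus_part G).
  by move=> e f g Gf Gg; have /(congr1 (@sval _ _)) := e (exist _ f Gf) (exist _ g Gg).
have [[p pfix]|noglob] := pselect (exists p, forall k, act k p = p).
  left; split; first exact/abel/(global_abelian actsG fix3 pfix).
  move=> g x Gg g1 gx k Gk.
  have u1 : (exist _ g Gg : plus_group G_subgroup) <> 1%g by move=> /(congr1 (@sval _ _)).
  exact: (fixed_is_global actsG fix3 pfix u1 gx (exist _ k Gk)).
have moves : moves_all act setT.
  move=> x; apply: contrapT => hn; apply: noglob; exists x => k.
  by apply: contrapT => ne; apply: hn; exists k.
have [hfix|nofix] := pselect (exists g x, g <> 1%g /\ act g x = x); last first.
  have noP (g : plus_group G_subgroup) x : act g x = x -> g = 1%g.
    by move=> gx; apply: contrapT => g1; apply: nofix; exists g, x.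
  left; split.
    apply: abel => f g; apply: (free_abelian R (line_real R) actsG few (D := setT)) => //.
    by move=> k x _; exact: noP.
  move=> g x Gg g1 gx; case: g1.
  by have /(congr1 (@sval _ _)) := noP (exist _ g Gg) x gx.
right; have [subT [t0 Tt0 t0_gt1]] := fixfree_translations R (line_real R) actsG few moves hfix.
have [g0 [x0 [g01 g0x0]]] := hfix.
exact: (semi_conjugate_affine few subT Tt0 t0_gt1 g01 g0x0).
Qed.
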